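(* Let $(A,\Sigma,\mu)$ and $(B,\Xi,\nu)$ be $\sigma$-finite measure spaces, let $\Phi:\Sigma'\to\Xi'$ be a Boolean isomorphism, and let $T:L_0(\mu)\to L_0(\nu)$ be a regular orthogonally additive operator. Then the following statements are equivalent: (1) $T$ is continuous (with respect to the metrics $\rho_{L_0}$ on $L_0(\mu)$ and $L_0(\nu)$) and is an atomic operator subordinate to $\Phi$; (2) there exists a $\mathfrak{K}$-function $N:B\times\mathbb{R}\to\mathbb{R}$ such that $T=T_N\circ S_\Phi$, where $T_N$ is the superposition operator associated with $N$ and $S_\Phi$ is the shift operator associated with $\Phi$, that is, $$Tf=N(\cdot,S_\Phi f(\cdot))\qquad (f\in L_0(\mu)).$$
   Context: For a $\sigma$-finite measure space $(B,\Xi,\nu)$, $L_0(\nu)$ is the vector lattice of ($\nu$-a.e. equivalence classes of) real-valued measurable functions on $B$. Choose a finite measure $\lambda$ on $\Xi$ with the same null sets as $\nu$; the metric on $L_0(\nu)$ is $$\rho_{L_0}(f,g)=\int_B\frac{|f-g|}{1+|f-g|}\,d\lambda,$$ whose convergence is convergence in measure with respect to $\lambda$. The metric on $L_0(\mu)$ is defined in the same way. $\Xi'=\Xi/\Xi_0$ is the quotient Boolean algebra of $\Xi$ by the ideal $\Xi_0$ of $\nu$-null sets; similarly $\Sigma'=\Sigma/\Sigma_0$ with $\Sigma_0$ the $\mu$-null sets. An order projection on a vector lattice $E$ is a positive linear projection $\pi$ with $0\le\pi\le Id$; these form a Boolean algebra $\mathfrak{B}(E)$. The map $D\mapsto\pi_D$,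 where $\pi_D$ is multiplication by the indicator function $1_D$, is an isomorphism of $\Xi'$ onto $\mathfrak{B}(L_0(\nu))$ (and likewise of $\Sigma'$ onto $\mathfrak{B}(L_0(\mu))$), so $\Phi$ is identified with a Boolean isomorphism $\mathfrak{B}(L_0(\mu))\to\mathfrak{B}(L_0(\nu))$. Operators are possibly nonlinear maps. $T:L_0(\mu)\to L_0(\nu)$ is atomic subordinate to $\Phi$ if $T\circ\pi=\Phi(\pi)\circ T$ for every $\pi\in\mathfrak{B}(L_0(\mu))$. $T$ is orthogonally additive if $T(f+g)=Tf+Tg$ whenever $|f|\wedge|g|=0$. It is positive if $Tf\ge0$ for all $f$. An orthogonally additive operator is regular if it is the difference of two positive orthogonally additive operators. A function $N:B\times\mathbb{R}\to\mathbb{R}$ is a $\mathfrak{K}$-function if: $N(s,0)=0$ for $\nu$-almost all $s\in B$; $N(\cdot,r)$ is measurable for all $r\in\mathbb{R}$; and $N(s,\cdot)$ is continuous on $\mathbb{R}$ for $\nu$-almost all $s\in B$. The superposition operator $T_N:L_0(\nu)\to L_0(\nu)$ is $T_Nf=N(\cdot,f(\cdot))$. The shift operator $S_\Phi:L_0(\mu)\to L_0(\nu)$ is the linear positive operator defined as follows. For a simple function $f=\sum_{i=1}^n r_i1_{A_i}\ge0$ with $A_i\in\Sigma$ mutually disjoint, $S_\Phi f=\sum_{i=1}^n r_i1_{\Phi(A_i)}$. For $f\in L_0(\mu)$ with $f\ge 0$, $S_\Phi f=\sup_nS_\Phi f_n$, where $(f_n)$ is any increasing sequence of positive simple functions with $f=\sup_nf_n$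 (this supremum exists in $L_0(\nu)$ and does not depend on the choice of $(f_n)$). For arbitrary $f$, $S_\Phi f=S_\Phi f_+-S_\Phi f_-$. *)

(* Defs.v *)
From HB Require Import structures.
From mathcomp Require Import all_boot all_order all_algebra.
From mathcomp Require Import all_classical all_reals all_analysis.
From mathcomp Require Import measurable_realfun.

Set Implicit Arguments.
Unset Strict Implicit.
Unset Printing Implicit Defensive.

Import Order.TTheory GRing.Theory Num.Def Num.Theory.
Import numFieldNormedType.Exports.

Local Open Scope classical_set_scope.
Local Open Scope ring_scope.
Local Open Scope quotient_scope.

Section measure_algebra.
Context d (T : measurableType d) (R : realType).
Variable mu : {measure set T -> \bar R}.

Definition measurable_set : choiceType := set_type (@measurable d T).

Implicit Types A B C : measurable_set.

Lemma msetP A : measurable (val A).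
Proof. exact/set_mem/valP. Qed.

Definition MSet (A : set T) (mA : measurable A) : measurable_set :=
  exist _ A (mem_set mA).

Definition msetI A B : measurable_set := MSet (measurableI _ _ (msetP A) (msetP B)).
Definition msetU A B : measurable_set := MSet (measurableU _ _ (msetP A) (msetP B)).
Definition msetC A : measurable_set := MSet (measurableC (msetP A)).
Definition mset0 : measurable_set := MSet measurable0.
Definition msetT : measurable_set := MSet measurableT.

Definition eq_mod_null A B : bool := mu (val A `+` val B) == 0%E.

Lemma eq_mod_nullP A B :
  eq_mod_null A B <-> \forall x \ae mu, val A x <-> val B x.
Proof.
have mAB : measurable (val A `+` val B).
  by apply: measurableU; apply: measurableD; exact: msetP.
have -> : (\forall x \ae mu, val A x <-> val B x) <->
    mu.-negligible (val A `+` val B).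
  rewrite /prop_near1 /= /nbhs /= /almost_everywhere.
  rewrite (_ : ~` _ = val A `+` val B)//.
  apply/seteqP; split => x /=.
    move=> h; apply: contrapT => h'; apply: h; split => H.
      by apply: contrapT => H'; apply: h'; left.
    by apply: contrapT => H'; apply: h'; right.
  by move=> [[a b] h|[b a] h]; [apply: b; apply/h|apply: a; apply/h].
rewrite negligibleP//; split; first by move/eqP.
by move=> ?; apply/eqP.
Qed.

Lemma eq_mod_null_refl : reflexive eq_mod_null.
Proof. by move=> A; apply/eq_mod_nullP; exact: aeW. Qed.

Lemma eq_mod_null_sym : symmetric eq_mod_null.
Proof. by move=> A B; rewrite /eq_mod_null setYC. Qed.

Lemma eq_mod_null_trans : transitive eq_mod_null.
Proof.
move=> B A C /eq_mod_nullP AB /eq_mod_nullP BC; apply/eq_mod_nullP.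
by apply: filterS2 AB BC => x -> ->.
Qed.

Canonical eq_mod_null_canonical :=
  EquivRel eq_mod_null eq_mod_null_refl eq_mod_null_sym eq_mod_null_trans.

Definition malg : Type := {eq_quot eq_mod_null}.
HB.instance Definition _ := Choice.on malg.
HB.instance Definition _ := EqQuotient.on malg.

Definition mclass A : malg := \pi A.

Implicit Types x y z : malg.

Lemma mclassP A B : mclass A = mclass B <-> \forall x \ae mu, val A x <-> val B x.
Proof.
rewrite -eq_mod_nullP; split => [/eqP|AB]; first by rewrite eqmodE.
by apply/eqP; rewrite eqmodE.
Qed.

Lemma mclass_ind (P : malg -> Prop) : (forall A, P (mclass A)) -> forall x, P x.
Proof. exact: quotW. Qed.

Lemma repr_mclass A : \forall x \ae mu, val (repr (mclass A)) x <-> val A x.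
Proof. by apply/mclassP; exact: reprK. Qed.

Definition malg_meet x y := mclass (msetI (repr x) (repr y)).
Definition malg_join x y := mclass (msetU (repr x) (repr y)).
Definition malg_compl x := mclass (msetC (repr x)).
Definition malg_bot := mclass mset0.
Definition malg_top := mclass msetT.
Definition malg_le x y := malg_meet x y == x.
Definition malg_lt x y := (y != x) && malg_le x y.

Lemma mclassI A B : malg_meet (mclass A) (mclass B) = mclass (msetI A B).
Proof.
by apply/mclassP; apply: filterS2 (repr_mclass A) (repr_mclass B) => x /= -> ->.
Qed.

Lemma mclassU A B : malg_join (mclass A) (mclass B) = mclass (msetU A B).
Proof.
by apply/mclassP; apply: filterS2 (repr_mclass A) (repr_mclass B) => x /= -> ->.
Qed.

Lemma mclassC A : malg_compl (mclass A) = mclass (msetC A).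
Proof. by apply/mclassP; apply: filterS (repr_mclass A) => x /= ->. Qed.

Lemma eq_mclass A B : val A = val B -> mclass A = mclass B.
Proof. by move=> /val_inj ->. Qed.

Lemma malg_meetC : commutative malg_meet.
Proof.
elim/mclass_ind => A; elim/mclass_ind => B; rewrite !mclassI.
by apply: eq_mclass; rewrite /= setIC.
Qed.

Lemma malg_joinC : commutative malg_join.
Proof.
elim/mclass_ind => A; elim/mclass_ind => B; rewrite !mclassU.
by apply: eq_mclass; rewrite /= setUC.
Qed.

Lemma malg_meetA : associative malg_meet.
Proof.
elim/mclass_ind => A; elim/mclass_ind => B; elim/mclass_ind => C.
by rewrite !mclassI; apply: eq_mclass; rewrite /= setIA.
Qed.

Lemma malg_joinA : associative malg_join.
Proof.
elim/mclass_ind => A; elim/mclass_ind => B; elim/mclass_ind => C.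
by rewrite !mclassU; apply: eq_mclass; rewrite /= setUA.
Qed.

Lemma malg_joinKI y x : malg_meet x (malg_join x y) = x.
Proof.
elim/mclass_ind: x => A; elim/mclass_ind: y => B.
by rewrite mclassU mclassI; apply: eq_mclass; rewrite /= setUC setKU.
Qed.

Lemma malg_meetKU y x : malg_join x (malg_meet x y) = x.
Proof.
elim/mclass_ind: x => A; elim/mclass_ind: y => B.
by rewrite mclassI mclassU; apply: eq_mclass; rewrite /= setIC setKI.
Qed.

Lemma malg_meetUl : left_distributive malg_meet malg_join.
Proof.
elim/mclass_ind => A; elim/mclass_ind => B; elim/mclass_ind => C.
by rewrite mclassU !mclassI mclassU; apply: eq_mclass; rewrite /= setIUl.
Qed.

Lemma malg_meetxx : idempotent_op malg_meet.
Proof.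
by elim/mclass_ind => A; rewrite mclassI; apply: eq_mclass; rewrite /= setIid.
Qed.

Fact malg_display : Order.disp_t. Proof. exact: Order.Disp tt tt. Qed.

HB.instance Definition _ := Order.isMeetJoinDistrLattice.Build malg_display malg
  (fun _ _ => erefl) (fun _ _ => erefl) malg_meetC malg_joinC malg_meetA malg_joinA malg_joinKI malg_meetKU
  malg_meetUl malg_meetxx.

Lemma malg_le0x x : (malg_bot <= x)%O.
Proof.
elim/mclass_ind: x => A; rewrite leEmeet; apply/eqP.
by rewrite /Order.meet /= mclassI; apply: eq_mclass; rewrite /= set0I.
Qed.

Lemma malg_lex1 x : (x <= malg_top)%O.
Proof.
elim/mclass_ind: x => A; rewrite leEmeet; apply/eqP.
by rewrite /Order.meet /= mclassI; apply: eq_mclass; rewrite /= setIT.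
Qed.

HB.instance Definition _ := Order.hasBottom.Build malg_display malg malg_le0x.
HB.instance Definition _ := Order.hasTop.Build malg_display malg malg_lex1.

Lemma malg_joinxC x : (x `|` malg_compl x = \top)%O.
Proof.
elim/mclass_ind: x => A; rewrite mclassC /Order.join /= mclassU.
by apply: eq_mclass; rewrite /= setUv.
Qed.

Lemma malg_meetxC x : (x `&` malg_compl x = \bot)%O.
Proof.
elim/mclass_ind: x => A; rewrite mclassC /Order.meet /= mclassI.
by apply: eq_mclass; rewrite /= setICr.
Qed.

HB.instance Definition _ :=
  Order.TBDistrLattice_hasComplement.Build malg_display malg malg_joinxC malg_meetxC.

End measure_algebra.

Definition boolean_isomorphism d1 d2 (B1 : ctbDistrLatticeType d1)
    (B2 : ctbDistrLatticeType d2) (Phi : B1 -> B2) : Prop :=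
  [/\ bijective Phi,
      {morph Phi : x y / (x `&` y)%O},
      {morph Phi : x y / (x `|` y)%O} &
      {morph Phi : x / (~` x)%O}].

Section L0.
Context d (T : measurableType d) (R : realType).
Variable mu : {measure set T -> \bar R}.

Definition L0 : Type := {mfun_ mu, T >-> R}.
HB.instance Definition _ := Choice.on L0.
HB.instance Definition _ := EqQuotient.on L0.

Definition L0_fun (f : L0) : {mfun T >-> R} := repr f.
Coercion L0_fun : L0 >-> MeasurableFun.type.

Definition L0class (f : {mfun T >-> R}) : L0 := \pi f.

Implicit Types f g h : L0.

Lemma L0P f g : f = g <-> \forall x \ae mu, f x = g x.
Proof.
split=> [->|fg]; first exact: aeW.
rewrite -[f]reprK -[g]reprK; apply/eqP; rewrite eqmodE; apply/asboolP.
by apply: filterS fg => x fg _.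
Qed.

Lemma L0classE (f : {mfun T >-> R}) : \forall x \ae mu, L0class f x = f x.
Proof.
have /eqP : \pi_L0 (L0_fun (L0class f)) = \pi f by exact: reprK.
by rewrite eqmodE => /asboolP; apply: filterS => x; exact.
Qed.

Definition L0zero : L0 := L0class 0.
Definition L0opp f : L0 := L0class (- (f : {mfun T >-> R})).
Definition L0add f g : L0 := L0class ((f : {mfun T >-> R}) + g).
Definition L0scale (r : R) f : L0 := L0class (r *: (f : {mfun T >-> R})).
Definition L0meet f g : L0 := L0class (f \min g : {mfun T >-> R}).
Definition L0join f g : L0 := L0class (f \max g : {mfun T >-> R}).
Definition L0le f g : bool := `[< \forall x \ae mu, f x <= g x >].

Lemma L0zeroE : \forall x \ae mu, L0zero x = 0. Proof. exact: L0classE. Qed.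
Lemma L0oppE f : \forall x \ae mu, L0opp f x = - f x. Proof. exact: L0classE. Qed.
Lemma L0addE f g : \forall x \ae mu, L0add f g x = f x + g x.
Proof. exact: L0classE. Qed.
Lemma L0scaleE r f : \forall x \ae mu, L0scale r f x = r * f x.
Proof. exact: L0classE. Qed.
Lemma L0meetE f g : \forall x \ae mu, L0meet f g x = Num.min (f x) (g x).
Proof. exact: L0classE. Qed.
Lemma L0joinE f g : \forall x \ae mu, L0join f g x = Num.max (f x) (g x).
Proof. exact: L0classE. Qed.

Lemma L0addA : associative L0add.
Proof.
move=> f g h; apply/L0P.
near=> x.
rewrite (near (L0addE f (L0add g h)) x)// (near (L0addE g h) x)//.
by rewrite (near (L0addE (L0add f g) h) x)// (near (L0addE f g) x)// addrA.
Unshelve. all: end_near. Qed.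

Lemma L0addC : commutative L0add.
Proof.
move=> f g; apply/L0P; near=> x.
by rewrite (near (L0addE f g) x)// (near (L0addE g f) x)// addrC.
Unshelve. all: end_near. Qed.

Lemma L0add0 : left_id L0zero L0add.
Proof.
move=> f; apply/L0P; near=> x.
by rewrite (near (L0addE L0zero f) x)// (near L0zeroE x)// add0r.
Unshelve. all: end_near. Qed.

Lemma L0addN : left_inverse L0zero L0opp L0add.
Proof.
move=> f; apply/L0P; near=> x.
rewrite (near (L0addE (L0opp f) f) x)// (near (L0oppE f) x)// (near L0zeroE x)//.
by rewrite addNr.
Unshelve. all: end_near. Qed.

HB.instance Definition _ := GRing.isZmodule.Build L0 L0addA L0addC L0add0 L0addN.

Lemma L0scaleA a b f : L0scale a (L0scale b f) = L0scale (a * b) f.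
Proof.
apply/L0P; near=> x.
rewrite (near (L0scaleE a (L0scale b f)) x)// (near (L0scaleE b f) x)//.
by rewrite (near (L0scaleE (a * b) f) x)// mulrA.
Unshelve. all: end_near. Qed.

Lemma L0scale1 : left_id 1 L0scale.
Proof.
move=> f; apply/L0P; near=> x.
by rewrite (near (L0scaleE 1 f) x)// mul1r.
Unshelve. all: end_near. Qed.

Lemma L0scaleDr : right_distributive L0scale +%R.
Proof.
move=> a f g; apply/L0P; near=> x.
rewrite (near (L0scaleE a (L0add f g)) x)// (near (L0addE f g) x)//.
rewrite (near (L0addE (L0scale a f) (L0scale a g)) x)//.
by rewrite (near (L0scaleE a f) x)// (near (L0scaleE a g) x)// mulrDr.
Unshelve. all: end_near. Qed.

Lemma L0scaleDl f : {morph L0scale^~ f : a b / a + b}.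
Proof.
move=> a b; apply/L0P; near=> x.
rewrite (near (L0scaleE (a + b) f) x)//.
rewrite (near (L0addE (L0scale a f) (L0scale b f)) x)//.
by rewrite (near (L0scaleE a f) x)// (near (L0scaleE b f) x)// mulrDl.
Unshelve. all: end_near. Qed.

HB.instance Definition _ :=
  GRing.Zmodule_isLmodule.Build R L0 L0scaleA L0scale1 L0scaleDr L0scaleDl.

Lemma L0le_refl : reflexive L0le.
Proof. by move=> f; apply/asboolP; exact: aeW. Qed.

Lemma L0le_anti : antisymmetric L0le.
Proof.
move=> f g /andP[/asboolP fg /asboolP gf]; apply/L0P.
by apply: filterS2 fg gf => x fg gf; apply/eqP; rewrite eq_le fg.
Qed.

Lemma L0le_trans : transitive L0le.
Proof.
move=> g f h /asboolP fg /asboolP gh; apply/asboolP.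
by apply: filterS2 fg gh => x; exact: le_trans.
Qed.

HB.instance Definition _ :=
  Order.Le_isPOrder.Build ring_display L0 L0le_refl L0le_anti L0le_trans.

Lemma L0le_meet f g h : (f <= L0meet g h) = (f <= g) && (f <= h).
Proof.
apply/asboolP/andP.
- move=> H; split; apply/asboolP; apply: filterS2 H (L0meetE g h) => x + E;
  by rewrite E le_min => /andP[].
- move=> [/asboolP fg /asboolP fh]; near=> x.
  by rewrite (near (L0meetE g h) x)// le_min (near fg x)// (near fh x).
Unshelve. all: end_near. Qed.

Lemma L0ge_join f g h : (L0join f g <= h) = (f <= h) && (g <= h).
Proof.
apply/asboolP/andP.
- move=> H; split; apply/asboolP; apply: filterS2 H (L0joinE f g) => x + E;
  by rewrite E ge_max => /andP[].
- move=> [/asboolP fg /asboolP fh]; near=> x.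
  by rewrite (near (L0joinE f g) x)// ge_max (near fg x)// (near fh x).
Unshelve. all: end_near. Qed.

HB.instance Definition _ :=
  Order.POrder_MeetJoin_isLattice.Build ring_display L0 L0le_meet L0ge_join.

Lemma L0_0E : \forall x \ae mu, (0 : L0) x = 0. Proof. exact: L0zeroE. Qed.
Lemma L0_NE f : \forall x \ae mu, (- f : L0) x = - f x. Proof. exact: L0oppE. Qed.
Lemma L0_DE f g : \forall x \ae mu, (f + g : L0) x = f x + g x.
Proof. exact: L0addE. Qed.
Lemma L0_ZE r f : \forall x \ae mu, (r *: f : L0) x = r * f x.
Proof. exact: L0scaleE. Qed.
Lemma L0_meetE f g : \forall x \ae mu, (f `&` g : L0)%O x = Num.min (f x) (g x).
Proof. exact: L0meetE. Qed.
Lemma L0_joinE f g : \forall x \ae mu, (f `|` g : L0)%O x = Num.max (f x) (g x).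
Proof. exact: L0joinE. Qed.
Lemma L0_leP f g : f <= g <-> \forall x \ae mu, f x <= g x.
Proof. by split=> /asboolP. Qed.

Definition L0abs f : L0 := (f `|` - f)%O.
Definition L0pos f : L0 := (f `|` 0)%O.
Definition L0neg f : L0 := (- f `|` 0)%O.

Definition rho (lambda : {measure set T -> \bar R}) f g : R :=
  (\int[lambda]_x (`|f x - g x| / (1 + `|f x - g x|)))%R.

Definition L0indic (D : malg mu) : L0 :=
  L0class (mindic R (msetP (repr D)) : {mfun T >-> R}).

Definition L0proj (D : malg mu) f : L0 :=
  L0class ((mindic R (msetP (repr D)) : {mfun T >-> R}) * f).

Definition order_projection (p : L0 -> L0) : Prop :=
  [/\ linear p, forall f, p (p f) = p f & forall f, 0 <= f -> 0 <= p f <= f].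

(* D |-> L0proj D is a bijection from the measure algebra onto the order
   projections; this is its inverse, with a junk value elsewhere *)
Definition proj_class (p : L0 -> L0) : malg mu :=
  xget (malg_bot mu) [set D | L0proj D = p].

End L0.

Definition same_null_sets (R : realType) d (T : measurableType d)
    (mu lambda : {measure set T -> \bar R}) : Prop :=
  forall E : set T, measurable E -> mu E = 0%E <-> lambda E = 0%E.

Section operators.
Context (R : realType) d1 (A : measurableType d1) d2 (B : measurableType d2).
Variables (mu : {measure set A -> \bar R}) (nu : {measure set B -> \bar R}).
Implicit Types (Phi : malg mu -> malg nu) (T : L0 mu -> L0 nu).

Definition rho_continuous (lmu : {measure set A -> \bar R})
    (lnu : {measure set B -> \bar R}) T : Prop :=
  forall f (e : R), 0 < e -> exists2 delta : R, 0 < delta &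
    forall g, rho lmu f g < delta -> rho lnu (T f) (T g) < e.

Definition orthogonally_additive T : Prop :=
  forall f g, (L0abs f `&` L0abs g)%O = 0 -> T (f + g) = T f + T g.

Definition positive_operator T : Prop := forall f, 0 <= T f.

Definition regular_operator T : Prop :=
  exists T1 T2 : L0 mu -> L0 nu,
    [/\ orthogonally_additive T1 /\ positive_operator T1,
        orthogonally_additive T2 /\ positive_operator T2 &
        forall f, T f = T1 f - T2 f].

(* Phi seen as a map between the algebras of order projections, through the
   identification D |-> L0proj D on both sides *)
Definition Phi_proj Phi (p : L0 mu -> L0 mu) : L0 nu -> L0 nu :=
  L0proj (Phi (proj_class p)).

Definition atomic_subordinate Phi T : Prop :=
  forall p, order_projection p -> T \o p = Phi_proj Phi p \o T.

(* u is a positive simple function and v is its shift by Phi; the r i may be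
   negative when E i is null, as only the class of u is required to be >= 0 *)
Definition shift_simple Phi (u : L0 mu) (v : L0 nu) : Prop :=
  exists (n : nat) (r : 'I_n -> R) (E : 'I_n -> measurable_set A),
    [/\ forall i j, i != j -> val (E i) `&` val (E j) = set0,
        u = \sum_(i < n) r i *: L0indic (mclass mu (E i)),
        0 <= u &
        v = \sum_(i < n) r i *: L0indic (Phi (mclass mu (E i)))].

Definition shift_sup Phi (f : L0 mu) (g : L0 nu) : Prop :=
  exists (u : nat -> L0 mu) (v : nat -> L0 nu),
    [/\ forall n, u n <= u n.+1,
        forall n, shift_simple Phi (u n) (v n),
        supremums (range u) f &
        supremums (range v) g].

(* For f >= 0 and a Boolean isomorphism Phi exactly one g satisfies
   shift_sup Phi f g, whatever the approximating sequence *)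
Definition shift_operator_pos Phi (f : L0 mu) : L0 nu :=
  xget 0 [set g | shift_sup Phi f g].

Definition shift_operator Phi (f : L0 mu) : L0 nu :=
  shift_operator_pos Phi (L0pos f) - shift_operator_pos Phi (L0neg f).

End operators.

Section superposition.
Context (R : realType) d (B : measurableType d).
Variable nu : {measure set B -> \bar R}.
Implicit Types N : B -> R -> R.
Import HBSimple.

Definition K_function N : Prop :=
  [/\ \forall s \ae nu, N s 0 = 0,
      forall r, measurable_fun setT (N ^~ r) &
      \forall s \ae nu, continuous (N s)].

(* N s (f s) need not be measurable on the null set where N s is not
   continuous: the value is the class of the measurable functions that are
   almost everywhere equal to it *)
Definition superposition N (f : L0 nu) : L0 nu :=
  xget 0 [set g : L0 nu | \forall s \ae nu, g s = N s (f s)].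

Lemma superpositionE N f : K_function N ->
  \forall s \ae nu, superposition N f s = N s (f s).
Proof.
move=> [_ mN [E [mE E0 subE]]].
pose M s r := if s \in E then 0 else N s r.
have mM r : measurable_fun setT (M ^~ r).
  apply: measurable_fun_ifT => //.
  by apply: (measurable_fun_bool true); rewrite setTI preimage_mem_true.
have cM s : continuous (M s).
  rewrite /M; case: (boolP (s \in E)) => [_|sE]; first by move=> ?; exact: cvg_cst.
  apply: contrapT => h; move/negP: sE; apply; apply/mem_set; exact: subE.
have mf : measurable_fun setT (EFin \o f) by exact/measurable_EFinP.
have [g gf] := approximation_sfun measurableT mf.
have {}gf s : g n s @[n --> \oo] --> f s by have /fine_cvg := gf s I.
have mMf : measurable_fun setT (fun s => M s (f s)).
  apply: (@measurable_fun_cvg _ _ _ _ (fun n s => M s (g n s))); last first.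
    move=> s _; apply: (cvg_comp _ _ (gf s)); exact: cM.
  move=> n _ S mS; rewrite setTI.
  rewrite [X in measurable X](_ : _ = \bigcup_(r in range (g n))
      ((g n @^-1` [set r]) `&` ((M ^~ r) @^-1` S))).
    apply: fin_bigcup_measurable; first exact: fimfunP.
    move=> r _; apply: measurableI; first exact: measurable_funPTI.
    by rewrite -[X in measurable X]setTI; exact: mM.
  apply/seteqP; split => s /=; first by exists (g n s).
  by move=> [r _] [<-].
have MN : \forall s \ae nu, M s (f s) = N s (f s).
  exists E; split => // s /=; rewrite /M.
  by case: (boolP (s \in E)) => [/set_mem|].
rewrite /superposition; case: xgetP => [h -> //|].
move=> /(_ (L0class nu (mfun_Sub (mem_set mMf)))) [].
by apply: filterS2 (L0classE nu (mfun_Sub (mem_set mMf))) MN => s -> <-.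
Qed.

End superposition.

(* Main.v *)
Require Import Defs.
From mathcomp Require Import all_boot all_order all_algebra.
From mathcomp Require Import all_classical all_reals all_analysis.
From mathcomp Require Import measurable_realfun ring lra.
Set Implicit Arguments.
Unset Strict Implicit.
Unset Printing Implicit Defensive.
Import Order.TTheory GRing.Theory Num.Def Num.Theory.
Import numFieldNormedType.Exports.
Local Open Scope classical_set_scope.
Local Open Scope ring_scope.

(** Phi transports the level sets {f > r} of a measurable function f, and the
    transported sets are the level sets of a unique g = S_Phi f. Hence S_Phi is
    a bijective additive order isomorphism, which preserves almost everywhere
    convergence because non-convergence is a countable Boolean combination of
    level sets. For a metric rho_L0, rho(f, g_n) < 2^-n forces g_n -> f almost
    everywhere, and almost everywhere convergence implies rho-convergence; so
    T_N o S_Phi is continuous.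

    Conversely V = T o S_Phi^-1 commutes with multiplication by indicators, and
    V u is the limit of V q (s) as the rational q tends to u(s), for almost every
    s: otherwise a measurable choice of bad rationals contradicts continuity at
    u. Applied to a measurable cluster point u of bad rationals, this also shows
    that q |-> V q (s) is uniformly continuous on bounded sets for almost every
    s; N(s, .) is its continuous extension. *)

(** * Convergence in the metric [rho] and almost everywhere convergence *)

Lemma same_null_ae (R : realType) d (T : measurableType d)
    (mu lam : {measure set T -> \bar R}) (P : T -> Prop) :
  same_null_sets mu lam ->
  (\forall x \ae mu, P x) <-> (\forall x \ae lam, P x).
Proof.
move=> h; split=> -[E [mE E0 PE]]; exists E; split => //.
- exact/(h _ mE).1.
- exact/(h _ mE).2.
Qed.

Section rho_convergence.
Context (R : realType) d (T : measurableType d).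
Variables (mu : {measure set T -> \bar R}) (lam : {finite_measure set T -> \bar R}).
Hypothesis hlam : same_null_sets mu lam.
Implicit Types (f g : L0 mu).

Definition rho_integrand f g (x : T) : R := `|f x - g x| / (1 + `|f x - g x|).

Lemma rho_integrand_ge0 f g x : 0 <= rho_integrand f g x.
Proof. by rewrite /rho_integrand divr_ge0// addr_ge0. Qed.

Lemma rho_integrand_lt1 f g x : rho_integrand f g x < 1.
Proof.
by rewrite /rho_integrand ltr_pdivrMr ?mul1r ?ltrDr// ltr_pwDl.
Qed.

(** This inverts [t / (1 + t)], so that integrands tending to 0 force the differences themselves to
    tend to 0. *)
Lemma rho_integrandK f g x :
  `|f x - g x| = rho_integrand f g x / (1 - rho_integrand f g x).
Proof.
rewrite /rho_integrand; set t := `|_|.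
have t0 : 0 <= t by rewrite /t.
field.
by apply/andP; split; apply/negP => /eqP; lra.
Qed.

Lemma measurable_rho_integrand f g : measurable_fun setT (rho_integrand f g).
Proof.
have -> : rho_integrand f g = (fun t : R => `|t| / (1 + `|t|)) \o (f \- g) by [].
apply: measurableT_comp; last exact: measurable_funB.
apply: continuous_measurable_fun => t.
have ct : `|x| @[x --> t] --> `|t| by apply: cvg_norm; exact: cvg_id.
apply: cvgM => //; apply: cvgV; first by rewrite gt_eqF// ltr_pwDl.
by apply: cvgD => //; exact: cvg_cst.
Qed.

Lemma integrable_rho_integrand f g :
  lam.-integrable setT (EFin \o rho_integrand f g).
Proof.
apply: (@le_integrable _ _ _ lam setT measurableT _ (EFin \o cst 1)).
- exact/measurable_EFinP/measurable_rho_integrand.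
- move=> x _ /=; rewrite lee_fin normr1 ger0_norm ?rho_integrand_ge0//.
  exact/ltW/rho_integrand_lt1.
- exact: finite_measure_integrable_cst.
Qed.

Lemma rhoE f g :
  (rho lam f g)%:E = (\int[lam]_x (rho_integrand f g x)%:E)%E.
Proof.
rewrite /rho /Rintegral fineK//.
exact: (integrable_fin_num measurableT (integrable_rho_integrand f g)).
Qed.

(** Dominated convergence applies with the constant bound 1, which is integrable because [lam] is
    finite. *)
Lemma rho_cvg0 f (g : nat -> L0 mu) :
  (\forall x \ae mu, g n x @[n --> \oo] --> f x) ->
  rho lam f (g n) @[n --> \oo] --> (0 : R).
Proof.
move=> /(same_null_ae _ hlam) gf.
have [] := @dominated_convergence _ _ _ lam setT measurableT
  (fun n => EFin \o rho_integrand f (g n)) (cst 0%E) (cst 1%E).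
- by move=> n; exact/measurable_EFinP/measurable_rho_integrand.
- exact: measurable_cst.
- apply: filterS gf => x gfx _ /=.
  apply: cvg_EFin; first exact: nearW.
  have d0 : `|f x - g n x| @[n --> \oo] --> (0 : R).
    rewrite -(normr0 R); apply: cvg_norm.
    by rewrite -(subrr (f x)); apply: cvgB => //; exact: cvg_cst.
  rewrite /rho_integrand /=.
  rewrite [X in _ --> X](_ : _ = 0 / (1 + 0) :> R); last by rewrite mul0r.
  apply: cvgM => //.
  apply: cvgV; first by rewrite addr0 oner_neq0.
  by apply: cvgD => //; exact: cvg_cst.
- exact: finite_measure_integrable_cst.
- apply: aeW => x n _ /=; rewrite lee_fin ger0_norm ?rho_integrand_ge0//.
  exact/ltW/rho_integrand_lt1.
move=> _ _ /=; rewrite integral0 => h.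
exact: (fine_cvg h).
Qed.

(** The series of the integrands has integral at most the sum of the [2 ^- n.+1], which is 1. It is
    therefore finite almost everywhere, and its terms tend to 0. *)
Lemma rho_fast_ae_cvg f (g : nat -> L0 mu) :
  (forall n, rho lam f (g n) < 2 ^- n.+1) ->
  \forall x \ae mu, g n x @[n --> \oo] --> f x.
Proof.
move=> gf; apply/(same_null_ae _ hlam).
pose F x := (\sum_(n <oo) (rho_integrand f (g n) x)%:E)%E.
have mF n : measurable_fun setT (EFin \o rho_integrand f (g n)).
  exact/measurable_EFinP/measurable_rho_integrand.
have F0 n x : setT x -> (0 <= (rho_integrand f (g n) x)%:E)%E.
  by move=> _; rewrite lee_fin rho_integrand_ge0.
have iF : lam.-integrable setT F.
  apply/integrableP; split.
    exact: (@ge0_emeasurable_sum _ _ _ _ _ xpredT (fun n x Dx _ => F0 n x Dx)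
      (fun n _ => mF n)).
  rewrite [X in (X < _)%E](_ : _ = \int[lam]_x F x)%E; last first.
    by apply: eq_integral => x _; rewrite gee0_abs//;
      apply: nneseries_ge0 => n _ _; exact: F0.
  rewrite integral_nneseries//.
  apply: (@le_lt_trans _ _ (\sum_(n <oo) (2 ^- n.+1 : R)%:E)%E).
    apply: lee_nneseries => [n *|n * /=].
      by apply: integral_ge0 => x _; exact: F0.
    by rewrite -rhoE lee_fin; exact/ltW/gf.
  have /cvg_lim := @cvg_geometric_eseries_half R 1 0.
  rewrite expr0 divr1 => /(_ (@ereal_hausdorff R)) H.
  rewrite (_ : (\sum_(n <oo) _)%E = 1%E) ?ltry// -H.
  apply: congr_lim; apply/funext => n; apply: eq_bigr => i _.
  by rewrite addn1 div1r natrX.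
have := integrable_ae measurableT iF.
apply: filterS => x /(_ I) Fx.
have h0 : rho_integrand f (g n) x @[n --> \oo] --> (0 : R).
  apply: cvg_series_cvg_0; apply: nnseries_is_cvg.
    by move=> n; exact: rho_integrand_ge0.
  by move: Fx; rewrite fin_numE /F => /andP[_]; rewrite -ltey.
have h1 : `|f x - g n x| @[n --> \oo] --> (0 : R).
  rewrite [X in X @ _ --> _](_ : _ = fun n =>
    rho_integrand f (g n) x / (1 - rho_integrand f (g n) x)).
    rewrite [X in _ --> X](_ : _ = 0 / (1 - 0) :> R); last by rewrite mul0r.
    apply: cvgM => //; apply: cvgV; first by rewrite subr0 oner_neq0.
    by apply: cvgB => //; exact: cvg_cst.
  by apply/funext => n; exact: rho_integrandK.
apply/cvgrPdist_lt => e e0; move/cvgr0Pnorm_lt : h1 => /(_ e e0).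
by apply: filterS => n /=; rewrite normr_id.
Qed.

End rho_convergence.

(** If continuity failed at [f], counterexamples could be chosen so close to [f] that they converge
    to it almost everywhere without passing to a subsequence; their images would then approach [T f]
    in [rho]. *)
Lemma ae_cvg_rho_continuous (R : realType) dA (A : measurableType dA)
    dB (B : measurableType dB)
    (mu : {measure set A -> \bar R}) (nu : {measure set B -> \bar R})
    (lmu : {finite_measure set A -> \bar R})
    (lnu : {finite_measure set B -> \bar R}) (T : L0 mu -> L0 nu) :
  same_null_sets mu lmu -> same_null_sets nu lnu ->
  (forall (f : L0 mu) (g : nat -> L0 mu),
     (\forall x \ae mu, g n x @[n --> \oo] --> f x) ->
     \forall x \ae nu, T (g n) x @[n --> \oo] --> T f x) ->
  rho_continuous lmu lnu T.
Proof.
move=> hmu hnu hT f e e0; apply: contrapT => noD.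
have /choice[g gP] : forall n, exists g : L0 mu,
    rho lmu f g < 2 ^- n.+1 /\ e <= rho lnu (T f) (T g).
  move=> n; apply: contrapT => noG; apply: noD; exists (2 ^- n.+1) => //.
  move=> g fg; rewrite ltNge; apply/negP => eg; apply: noG.
  by exists g.
have gf := rho_fast_ae_cvg hmu (fun n => (gP n).1).
have /cvgr0Pnorm_lt/(_ _ e0)[n _ /(_ n (leqnn n))/=] := rho_cvg0 hnu (hT _ _ gf).
by rewrite ltNge => /negP; apply; apply: le_trans (gP n).2 (ler_norm _).
Qed.

(** * Level sets, countable families of almost everywhere statements, and correspondences of
    measurable sets *)

Lemma measurable_gtr (R : realType) d (T : measurableType d) (f : T -> R) r :
  measurable_fun setT f -> measurable [set x | r < f x].
Proof.
move=> mf; rewrite -[X in measurable X]setTI.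
rewrite (_ : [set x | r < f x] = f @^-1` `]r, +oo[); first exact: mf.
by apply/seteqP; split => x /=; rewrite in_itv/= andbT.
Qed.

Lemma ae_forall_count (R : realType) d (T : measurableType d)
    (mu : {measure set T -> \bar R}) (I : countType) (P : I -> T -> Prop) :
  (forall i, \forall x \ae mu, P i x) -> \forall x \ae mu, forall i, P i x.
Proof.
move=> h; have := @ae_foralln _ _ _ mu
  (fun n x => if unpickle n is Some i then P i x else True).
have h' n : \forall x \ae mu, if unpickle n is Some i then P i x else True.
  by case: (unpickle n) => [i|]; [exact: h|exact: aeW].
move=> /(_ h'); apply: filterS => x Px i.
by have := Px (pickle i); rewrite pickleK.
Qed.

Lemma measure0_aeN (R : realType) d (T : measurableType d)
    (mu : {measure set T -> \bar R}) (E : set T) : measurable E ->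
  mu E = 0%E <-> \forall x \ae mu, ~ E x.
Proof.
move=> mE; rewrite -(negligibleP mu mE) /prop_near1 /= /nbhs /= /almost_everywhere.
by rewrite (_ : ~` _ = E)//; apply/seteqP; split => x /=; [exact: contrapT|move=> Ex; exact].
Qed.

Lemma rat_between (R : realType) (a b : R) : a < b ->
  exists q : rat, a < ratr q < b.
Proof.
by move=> ab; have [q] := rat_in_itvoo ab; rewrite in_itv/=; exists q.
Qed.

(* A relation between measurable sets that behaves as the graph of a
   sigma-complete isomorphism of measure algebras; unlike the isomorphism it
   involves no choice of representatives, and it is symmetric. *)
Record null_corr (R : realType) dA (A : measurableType dA)
    dB (B : measurableType dB) (mu : {measure set A -> \bar R})
    (nu : {measure set B -> \bar R}) (tr : set A -> set B -> Prop) : Prop := {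
  corr_measurablel : forall E F, tr E F -> measurable E ;
  corr_measurabler : forall E F, tr E F -> measurable F ;
  corr_ae : forall E F E' F', tr E F -> measurable E' -> measurable F' ->
    (\forall x \ae mu, E x <-> E' x) -> (\forall y \ae nu, F y <-> F' y) ->
    tr E' F' ;
  corr_not : forall E F, tr E F -> tr [set x | ~ E x] [set y | ~ F y] ;
  corr_existsn : forall E F, (forall n : nat, tr (E n) (F n)) ->
    tr [set x | exists n, E n x] [set y | exists n, F n y] ;
  corr_null : forall E F, tr E F -> mu E = 0%E <-> nu F = 0%E ;
  corr_exr : forall E, measurable E -> exists F, tr E F ;
  corr_exl : forall F, measurable F -> exists E, tr E F }.

(** Existence, order and convergence results for the transport thereby hold for the inverse
    transport too. *)
Lemma null_corr_sym (R : realType) dA (A : measurableType dA)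
    dB (B : measurableType dB) (mu : {measure set A -> \bar R})
    (nu : {measure set B -> \bar R}) tr :
  null_corr mu nu tr -> null_corr nu mu (fun F E => tr E F).
Proof.
move=> h; split.
- by move=> E F; exact: corr_measurabler h _ _.
- by move=> E F; exact: corr_measurablel h _ _.
- by move=> E F E' F' t mE mF EE FF; apply: (corr_ae h t).
- by move=> E F; exact: corr_not h _ _.
- by move=> E F; exact: corr_existsn h _ _.
- by move=> E F /(corr_null h) ->.
- exact: corr_exl h.
- exact: corr_exr h.
Qed.

(** * Transport of countable formulas and of measurable functions *)

Section null_corr_theory.
Context (R : realType) dA (A : measurableType dA) dB (B : measurableType dB).
Variables (mu : {measure set A -> \bar R}) (nu : {measure set B -> \bar R}).
Variable tr : set A -> set B -> Prop.
Hypothesis htr : null_corr mu nu tr.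
Implicit Types (E : set A) (F : set B) (f : A -> R) (g : B -> R).

Lemma corr_nullP E F : tr E F ->
  (\forall x \ae mu, ~ E x) <-> (\forall y \ae nu, ~ F y).
Proof.
move=> t; rewrite -!measure0_aeN; first exact: corr_null htr _ _ t.
- exact: (corr_measurabler htr t).
- exact: (corr_measurablel htr t).
Qed.

(** The empty set corresponds to a null set, which [corr_ae] replaces by the empty set; complements
    give the full sets. Conditions that do not depend on the point can thus occur in transported
    formulas. *)
Lemma corr_const (P : Prop) : tr [set _ | P] [set _ | P].
Proof.
have t0 : tr set0 set0.
  have [F t] := corr_exr htr (@measurable0 _ A).
  apply: (corr_ae htr t) => //; first exact: aeW.
  have /(corr_nullP t) : \forall x \ae mu, ~ (set0 : set A) x by apply: aeW => x.
  by apply: filterS => y nF; split.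
have [p|p] := pselect P.
  rewrite (_ : [set _ | P] = [set x : A | ~ set0 x]); last first.
    by apply/seteqP; split => x /= // _ [].
  rewrite (_ : [set _ | P] = [set y : B | ~ set0 y]); last first.
    by apply/seteqP; split => x /= // _ [].
  exact: corr_not htr _ _ _.
rewrite (_ : [set _ | P] = (set0 : set A)); last by apply/seteqP; split.
by rewrite (_ : [set _ | P] = (set0 : set B)); last by apply/seteqP; split.
Qed.

Lemma corr_exists (I : countType) (E : I -> set A) (F : I -> set B) :
  (forall i, tr (E i) (F i)) ->
  tr [set x | exists i, E i x] [set y | exists i, F i y].
Proof.
move=> h; have := @corr_existsn _ _ _ _ _ _ _ _ htr
  (fun n => [set x | if unpickle n is Some i then E i x else False])
  (fun n => [set y | if unpickle n is Some i then F i y else False]).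
rewrite (_ : [set x : A | _] = [set x | exists i, E i x]); last first.
  apply/seteqP; split => x /=.
    by move=> [n]; case: (unpickle n) => // i; exists i.
  by move=> [i Ei]; exists (pickle i); rewrite pickleK.
rewrite (_ : [set x : B | _] = [set x | exists i, F i x]); last first.
  apply/seteqP; split => x /=.
    by move=> [n]; case: (unpickle n) => // i; exists i.
  by move=> [i Ei]; exists (pickle i); rewrite pickleK.
apply=> n; case: (unpickle n) => [i|]; last exact: corr_const.
exact: h.
Qed.

Lemma corr_forall (I : countType) (E : I -> set A) (F : I -> set B) :
  (forall i, tr (E i) (F i)) ->
  tr [set x | forall i, E i x] [set y | forall i, F i y].
Proof.
move=> h; rewrite (_ : [set x : A | _] = [set x | ~ exists i, ~ E i x]); last first.
  by apply/seteqP; split => x /=; [move=> + [i]; exact|move=> /forallNP + i => /(_ i) /contrapT].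
rewrite (_ : [set x : B | _] = [set x | ~ exists i, ~ F i x]); last first.
  by apply/seteqP; split => x /=; [move=> + [i]; exact|move=> /forallNP + i => /(_ i) /contrapT].
apply: (corr_not htr (E := [set x | exists i, ~ E i x]) (F := [set x | exists i, ~ F i x])).
apply: (corr_exists (E := fun i => [set x | ~ E i x]) (F := fun i => [set x | ~ F i x])) => i.
exact: corr_not htr _ _ _.
Qed.

Lemma corr_or E E' F F' : tr E F -> tr E' F' ->
  tr [set x | E x \/ E' x] [set y | F y \/ F' y].
Proof.
move=> t t'.
have := @corr_exists bool (fun b => if b then E else E') (fun b => if b then F else F').
rewrite (_ : [set x : A | _] = [set x | E x \/ E' x]); last first.
  by apply/seteqP; split => x /=; [move=> [[]]; [left|right]|move=> []; [exists true|exists false]].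
rewrite (_ : [set x : B | _] = [set x | F x \/ F' x]); last first.
  by apply/seteqP; split => x /=; [move=> [[]]; [left|right]|move=> []; [exists true|exists false]].
by apply; case.
Qed.

Lemma corr_and E E' F F' : tr E F -> tr E' F' ->
  tr [set x | E x /\ E' x] [set y | F y /\ F' y].
Proof.
move=> t t'.
have := @corr_forall bool (fun b => if b then E else E') (fun b => if b then F else F').
rewrite (_ : [set x : A | _] = [set x | E x /\ E' x]); last first.
  apply/seteqP; split => x /=; first by move=> h; split; [exact: h true|exact: h false].
  by move=> [? ?] [].
rewrite (_ : [set x : B | _] = [set x | F x /\ F' x]); last first.
  apply/seteqP; split => x /=; first by move=> h; split; [exact: h true|exact: h false].
  by move=> [? ?] [].
by apply; case.
Qed.

(** Inclusion up to a null set says that [E] minus [E'] is null, and corresponding sets are null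
    together. *)
Lemma corr_subset E E' F F' : tr E F -> tr E' F' ->
  (\forall x \ae mu, E x -> E' x) -> \forall y \ae nu, F y -> F' y.
Proof.
move=> t t' EE'; have T := corr_and t (corr_not htr t').
have /(corr_nullP T) : \forall x \ae mu, ~ (E x /\ ~ E' x).
  by apply: filterS EE' => x EE' [/EE'].
by apply: filterS => y h Fy; apply: contrapT => F'y; apply: h.
Qed.

(** Relational form of the shift operator. The sets [{f > r}] determine a function up to a null set,
    so neither an approximating sequence nor a representative has to be chosen. *)
Definition shifts f g := forall r : R, tr [set x | r < f x] [set y | r < g y].

(** A pointwise inequality amounts to inclusions of level sets at rational heights, and these are
    only countably many. *)
Lemma shifts_le f f' g g' : shifts f g -> shifts f' g' ->
  (\forall x \ae mu, f x <= f' x) -> \forall y \ae nu, g y <= g' y.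
Proof.
move=> h h' ff'.
have : \forall y \ae nu, forall q : rat, ratr q < g y -> ratr q < g' y.
  apply: ae_forall_count => q; apply: corr_subset (h _) (h' _) _.
  by apply: filterS ff' => x ff' /= /lt_le_trans; exact.
apply: filterS => y H; rewrite leNgt; apply/negP => /rat_between[q /andP[q1 q2]].
by have := H _ q2; rewrite ltNge (ltW q1).
Qed.

Lemma shifts_cst (c : R) : shifts (cst c) (cst c).
Proof. by move=> r; exact: (corr_const (r < c)). Qed.

(** [r < u + v] holds exactly when some rational [q] satisfies [q < u] and [r - q < v], which makes
    the level set of a sum a countable union. *)
Lemma shifts_add f f' g g' : shifts f g -> shifts f' g' ->
  shifts (f \+ f') (g \+ g').
Proof.
have addE (T : Type) (u v : T -> R) r : [set x | r < (u \+ v) x] =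
    [set x | exists q : rat, ratr q < u x /\ r - ratr q < v x].
  apply/seteqP; split => x /=.
    rewrite -ltrBlDr => /rat_between[q /andP[q1 q2]].
    by exists q; split => //; lra.
  by move=> [q [q1 q2]]; lra.
move=> h h' r; rewrite !addE.
apply: (@corr_exists rat (fun q => [set x | ratr q < f x /\ r - ratr q < f' x])
  (fun q => [set x | ratr q < g x /\ r - ratr q < g' x])) => q.
exact: corr_and (h _) (h' _).
Qed.

(** Inside [D] the level set is that of [f]; outside, it is everything or nothing according to the
    sign of [r]. *)
Lemma shifts_indicM f g D D' : tr D D' -> shifts f g ->
  shifts (\1_D \* f) (\1_D' \* g).
Proof.
have indE (T : Type) (u : T -> R) (S : set T) r : [set x | r < (\1_S \* u) x] =
    [set x | (S x /\ r < u x) \/ (~ S x /\ r < 0)].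
  apply/seteqP; split => x /=; rewrite indicE; have [Sx|Sx] := pselect (S x).
  - by rewrite mem_set// mul1r; left.
  - by rewrite memNset// mul0r; right.
  - by rewrite mem_set// mul1r => -[[]|[]].
  - by rewrite memNset// mul0r => -[[]|[]].
move=> t h r; rewrite !indE.
apply: corr_or (corr_and t (h r)) (corr_and (corr_not htr t) _).
exact: corr_const.
Qed.

Lemma shifts_ae f f' g g' : shifts f g ->
  measurable_fun setT f' -> measurable_fun setT g' ->
  (\forall x \ae mu, f x = f' x) -> (\forall y \ae nu, g y = g' y) ->
  shifts f' g'.
Proof.
move=> h mf mg ff gg r; apply: (corr_ae htr (h r)).
- exact: measurable_gtr.
- exact: measurable_gtr.
- by apply: filterS ff => x /= ->.
- by apply: filterS gg => x /= ->.
Qed.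

(** Two rational thresholds separate the limit from infinitely many terms. The only conditions on
    values are of the form [ratr q < _] or its negation, so the set can be transported piece by
    piece. *)
Definition noncvg_set (T : Type) (u_ : nat -> T -> R) (u : T -> R) : set T :=
  [set x | exists q : rat * rat, ratr q.1 < ratr q.2 :> R /\
    ((ratr q.2 < u x /\ forall k, exists n, (k <= n)%N /\ ~ ratr q.1 < u_ n x) \/
     (~ ratr q.1 < u x /\ forall k, exists n, (k <= n)%N /\ ratr q.2 < u_ n x))].

Lemma noncvg_setP (T : Type) (u_ : nat -> T -> R) (u : T -> R) x :
  ~ noncvg_set u_ u x <-> u_ n x @[n --> \oo] --> u x.
Proof.
split.
- move=> h; apply/cvgrPdist_lt => e e0.
  (* The pair [a < b] lies in [(u x - e, u x)] and the pair [c < d] in [(u x, u x + e)]. Neither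
     pair separates, so the terms eventually stay between [a] and [d]. *)
  have [b /andP[b1 b2]] : exists q : rat, u x - e < ratr q < u x by apply: rat_between; lra.
  have [a /andP[a1 a2]] : exists q : rat, u x - e < ratr q < (ratr b : R) by exact: rat_between.
  have [c /andP[c1 c2]] : exists q : rat, u x < ratr q < u x + e by apply: rat_between; lra.
  have [d /andP[d1 d2]] : exists q : rat, (ratr c : R) < ratr q < u x + e by exact: rat_between.
  have [k1 K1] : exists k, forall n, (k <= n)%N -> ratr a < u_ n x.
    apply: contrapT => H; apply: h; exists (a, b); split => //=; left; split => // k.
    apply: contrapT => H'; apply: H; exists k => n kn; apply: contrapT => H''.
    by apply: H'; exists n.
  have [k2 K2] : exists k, forall n, (k <= n)%N -> u_ n x <= ratr d.
    apply: contrapT => H; apply: h; exists (c, d); split => //=; right; split.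
      by apply/negP; rewrite -leNgt ltW.
    move=> k; apply: contrapT => H'; apply: H; exists k => n kn; rewrite leNgt.
    by apply/negP => H''; apply: H'; exists n.
  exists (maxn k1 k2) => // n /=; rewrite geq_max => /andP[/K1 n1 /K2 n2].
  by rewrite ltr_norml; apply/andP; split; lra.
- move=> uu [[a b] /= [ab]] [[bu H]|[/negP au H]].
  + have [k _ K] : \forall n \near \oo, ratr a < u_ n x.
      by apply: cvgr_gt uu _ _; exact: lt_trans bu.
    by have [n [kn]] := H k; apply; exact: K.
  + have [k _ K] : \forall n \near \oo, u_ n x < ratr b.
      by apply: cvgr_lt uu _ _; rewrite -leNgt in au; exact: le_lt_trans ab.
    have [n [kn]] := H k; rewrite ltNge => /negP; apply; apply/ltW; exact: K.
Qed.

Lemma shifts_cvg (f_ : nat -> A -> R) f (g_ : nat -> B -> R) g :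
  (forall n, shifts (f_ n) (g_ n)) -> shifts f g ->
  (\forall x \ae mu, f_ n x @[n --> \oo] --> f x) ->
  \forall y \ae nu, g_ n y @[n --> \oo] --> g y.
Proof.
move=> h_ h fcvg.
have : tr (noncvg_set f_ f) (noncvg_set g_ g).
  pose P (T : Type) (u_ : nat -> T -> R) (u : T -> R) (q : rat * rat) :=
    [set x | ratr q.1 < ratr q.2 :> R /\
    ((ratr q.2 < u x /\ forall k, exists n, (k <= n)%N /\ ~ ratr q.1 < u_ n x) \/
     (~ ratr q.1 < u x /\ forall k, exists n, (k <= n)%N /\ ratr q.2 < u_ n x))].
  apply: (@corr_exists _ (P A f_ f) (P B g_ g)) => q.
  apply: corr_and; first exact: corr_const.
  apply: corr_or; apply: corr_and.
  - exact: h.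
  - apply: (@corr_forall _ (fun k => [set x | exists n, (k <= n)%N /\ ~ ratr q.1 < f_ n x])
      (fun k => [set x | exists n, (k <= n)%N /\ ~ ratr q.1 < g_ n x])) => k.
    apply: (@corr_exists _ (fun n => [set x | (k <= n)%N /\ ~ ratr q.1 < f_ n x])
      (fun n => [set x | (k <= n)%N /\ ~ ratr q.1 < g_ n x])) => n.
    apply: corr_and; first exact: (corr_const (is_true _)).
    exact: (corr_not htr (h_ n _)).
  - exact: (corr_not htr (h _)).
  - apply: (@corr_forall _ (fun k => [set x | exists n, (k <= n)%N /\ ratr q.2 < f_ n x])
      (fun k => [set x | exists n, (k <= n)%N /\ ratr q.2 < g_ n x])) => k.
    apply: (@corr_exists _ (fun n => [set x | (k <= n)%N /\ ratr q.2 < f_ n x])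
      (fun n => [set x | (k <= n)%N /\ ratr q.2 < g_ n x])) => n.
    apply: corr_and; first exact: (corr_const (is_true _)).
    exact: h_.
move=> /corr_nullP[H _]; have : \forall y \ae nu, ~ noncvg_set g_ g y.
  by apply: H; apply: filterS fcvg => x /noncvg_setP.
by apply: filterS => y /noncvg_setP.
Qed.

(** A correspondent [G q] is chosen for each rational level set of [f], and [g] is the supremum of
    those [q] whose [G q] contains the point. Each level set of this supremum is a countable union
    of sets [G q]. *)
Lemma shifts_exists f : measurable_fun setT f ->
  exists2 g, measurable_fun setT g & shifts f g.
Proof.
move=> mf.
have /choice[G GP] : forall q : rat, exists F, tr [set x | ratr q < f x] F.
  by move=> q; exact: corr_exr htr _ (measurable_gtr _ mf).
pose ge y : \bar R := ereal_sup [set (ratr q)%:E | q in [set q : rat | G q y]].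
have geE (r : R) : [set y | (r%:E < ge y)%E] = [set y | exists q : rat, (r < ratr q) /\ G q y].
  apply/seteqP; split => y /=.
    by move=> /ereal_sup_gt[_ [q Gq <-]]; rewrite lte_fin; exists q.
  move=> [q [rq Gq]]; apply: (@lt_le_trans _ _ (ratr q)%:E); first by rewrite lte_fin.
  by apply: ereal_sup_ubound; exists q.
have gtr r : tr [set x | r < f x] [set y | (r%:E < ge y)%E].
  rewrite geE (_ : [set x | r < f x] =
      [set x | exists q : rat, (r < ratr q) /\ ratr q < f x]).
    apply: (@corr_exists _ (fun q : rat => [set x | (r < ratr q) /\ ratr q < f x])
      (fun q => [set y | (r < ratr q) /\ G q y])) => q.
    by apply: corr_and; [exact: corr_const|exact: GP].
  apply/seteqP; split => x /=; first by move=> /rat_between[q /andP[]]; exists q.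
  by move=> [q [/lt_trans]]; exact.
have mge : measurable_fun setT ge.
  move=> mT; apply: (measurability _ (ErealGenOInfty.measurableE R)) => //.
  move=> _ [_ [r ->] <-]; rewrite setTI.
  rewrite (_ : _ @^-1` _ = [set y | (r%:E < ge y)%E]).
    exact: (corr_measurabler htr (gtr r)).
  by apply/seteqP; split => y /=; rewrite in_itv/= andbT.
have mg : measurable_fun setT (fine \o ge) by exact: measurableT_comp.
(* The points where [ge] exceeds every natural number, or no negated one, correspond to the points
   where [f] does so, and there are none. *)
have gfin : \forall y \ae nu, ge y \is a fin_num.
  have hy : \forall y \ae nu, ~ (forall n : nat, (n%:R%:E < ge y)%E).
    have t := @corr_forall _ (fun n : nat => [set x | n%:R < f x])
      (fun n : nat => [set y | (n%:R%:E < ge y)%E]) (fun n => gtr n%:R).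
    apply/(corr_nullP t); apply: aeW => x /= /(_ (truncn `|f x|).+1).
    by rewrite ltNge => /negP; apply; rewrite (le_trans (ler_norm _))// ltW// truncnS_gt.
  have hNy : \forall y \ae nu, ~ (forall n : nat, ~ ((- n%:R)%:E < ge y)%E).
    have t := @corr_forall _ (fun n : nat => [set x | ~ - n%:R < f x])
      (fun n : nat => [set y | ~ ((- n%:R)%:E < ge y)%E])
      (fun n => corr_not htr (gtr (- n%:R))).
    apply/(corr_nullP t); apply: aeW => x /= /(_ (truncn `|f x|).+1); apply.
    by rewrite ltrNl (le_lt_trans (ler_norm _))// normrN truncnS_gt.
  apply: filterS2 hy hNy => y; case: (ge y) => //.
  by move=> h _; exfalso; apply: h => n; exact: ltry.
exists (fine \o ge) => // r; apply: (corr_ae htr (gtr r)) => //.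
- exact: measurable_gtr.
- exact: measurable_gtr.
- exact: aeW.
- by apply: filterS gfin => y yfin /=; rewrite -[X in (_ < X)%E]fineK.
Qed.

End null_corr_theory.

(** * From a Boolean isomorphism to the shift operator *)

Lemma malg_leP (R : realType) d (T : measurableType d)
    (mu : {measure set T -> \bar R}) (E F : measurable_set T) :
  (mclass mu E <= mclass mu F)%O <-> \forall x \ae mu, val E x -> val F x.
Proof.
rewrite leEmeet; split.
  move=> /eqP; rewrite /Order.meet /= mclassI => /mclassP.
  by apply: filterS => x /= [_ h] /h[].
move=> EF; apply/eqP; rewrite /Order.meet /= mclassI; apply/mclassP.
by apply: filterS EF => x EF /=; split => [[]|Ex]//; split => //; exact: EF.
Qed.

Section boolean_isomorphism_corr.
Context (R : realType) dA (A : measurableType dA) dB (B : measurableType dB).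
Variables (mu : {measure set A -> \bar R}) (nu : {measure set B -> \bar R}).
Variable Phi : malg mu -> malg nu.
Hypothesis hPhi : boolean_isomorphism Phi.

Definition iso_corr (E : set A) (F : set B) : Prop :=
  exists (mE : measurable E) (mF : measurable F),
    Phi (mclass mu (MSet mE)) = mclass nu (MSet mF).

Lemma iso_le x y : (Phi x <= Phi y)%O = (x <= y)%O.
Proof.
have [bPhi hI _ _] := hPhi; rewrite !leEmeet -hI; apply/eqP/eqP => [|->//].
exact: bij_inj bPhi _ _.
Qed.

Lemma iso_surj (y : malg nu) : exists x, Phi x = y.
Proof. by have [[G _ K] _ _ _] := hPhi; exists (G y). Qed.

(** Only finite operations are assumed to be preserved. Countable unions follow because [Phi] is an
    order isomorphism and the class of a countable union is the supremum of the classes. *)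
Lemma iso_corrP : null_corr mu nu iso_corr.
Proof.
have [bPhi _ _ hC] := hPhi.
split.
- by move=> E F [].
- by move=> E F [mE []].
- move=> E F E' F' [mE [mF EF]] mE' mF' EE' FF'; exists mE', mF'.
  have <- : mclass mu (MSet mE) = mclass mu (MSet mE') by apply/mclassP.
  by rewrite EF; apply/mclassP.
- move=> E F [mE [mF EF]].
  exists (measurableC mE), (measurableC mF).
  have := hC (mclass mu (MSet mE)); rewrite EF /Order.compl /= !mclassC => H.
  transitivity (mclass nu (msetC (MSet mF))); last exact: eq_mclass.
  by rewrite -H; congr Phi; exact: eq_mclass.
- move=> E F EF.
  have mE n : measurable (E n) by have [] := EF n.
  have mF n : measurable (F n) by have [? []] := EF n.
  have mUE : measurable [set x | exists n, E n x].
    rewrite (_ : [set x | _] = \bigcup_n E n); first exact: bigcupT_measurable.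
    by apply/seteqP; split => x /= [n]; [exists n|move=> _ Enx; exists n].
  have mUF : measurable [set x | exists n, F n x].
    rewrite (_ : [set x | _] = \bigcup_n F n); first exact: bigcupT_measurable.
    by apply/seteqP; split => x /= [n]; [exists n|move=> _ Enx; exists n].
  exists mUE, mUF.
  have {}EF n : Phi (mclass mu (MSet (mE n))) = mclass nu (MSet (mF n)).
    have [mE' [mF' H]] := EF n.
    have -> : MSet (mE n) = MSet mE' by exact: val_inj.
    by rewrite H; apply: eq_mclass.
  apply/eqP; rewrite eq_le; apply/andP; split.
  (* The preimage [G] of the union of the [F n] bounds every [E n], hence their union. In the other
     half, [G] represents the image of the union of the [E n] and bounds every [F n]. *)
  + have [x] := iso_surj (mclass nu (MSet mUF)).
    elim/mclass_ind : x => G GE; rewrite -GE iso_le; apply/malg_leP.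
    have H n : \forall x \ae mu, E n x -> val G x.
      apply/(malg_leP mu (MSet (mE n))); rewrite -iso_le EF GE.
      by apply/malg_leP; apply: aeW => y /= Fy; exists n.
    by have := ae_foralln H; apply: filterS => x h [n /h].
  + move HG : (Phi _) => y; elim/mclass_ind : y HG => G GE; apply/malg_leP.
    have H n : \forall x \ae nu, F n x -> val G x.
      apply/(malg_leP nu (MSet (mF n))); rewrite -EF -GE iso_le.
      by apply/malg_leP; apply: aeW => y /= Fy; exists n.
    by have := ae_foralln H; apply: filterS => x h [n /h].
- move=> E F [mE [mF EF]].
  have Phi0 : Phi (mclass mu (mset0 A)) = mclass nu (mset0 B).
    apply/eqP; rewrite eq_le; apply/andP; split.
      have [x xE] := iso_surj (mclass nu (mset0 B)); rewrite -xE iso_le.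
      by elim/mclass_ind : x {xE} => G; apply/malg_leP; apply: aeW.
    by move: (Phi _) => y; elim/mclass_ind : y => G; apply/malg_leP; apply: aeW.
  have nullE d (T : measurableType d) (m : {measure set T -> \bar R})
      (S : set T) (mS : measurable S) :
      m S = 0%E <-> mclass m (MSet mS) = mclass m (mset0 T).
    rewrite mclassP measure0_aeN//.
    by split; apply: filterS => x /= h; [split|case: h].
  rewrite (nullE _ _ mu E mE) (nullE _ _ nu F mF) -EF -Phi0; split => [->//|].
  exact: bij_inj bPhi _ _.
- move=> E mE; move HG : (Phi (mclass mu (MSet mE))) => y.
  elim/mclass_ind : y HG => G GE; exists (val G), mE, (msetP G).
  by rewrite GE; apply: eq_mclass.
- move=> F mF; have [x] := iso_surj (mclass nu (MSet mF)).
  elim/mclass_ind : x => G GE; exists (val G), (msetP G), mF.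
  by rewrite -GE; congr Phi; exact: eq_mclass.
Qed.

Lemma iso_corr_repr (D : malg mu) : iso_corr (val (repr D)) (val (repr (Phi D))).
Proof.
exists (msetP (repr D)), (msetP (repr (Phi D))).
rewrite [X in Phi X](_ : _ = D); last by rewrite -[RHS]reprK; exact: eq_mclass.
by rewrite -[LHS]reprK; exact: eq_mclass.
Qed.

Let htr := iso_corrP.

Lemma shifts_classE (f : L0 mu) (g : L0 nu) (f' : A -> R) (g' : B -> R) :
  shifts iso_corr f' g' ->
  (\forall x \ae mu, f x = f' x) -> (\forall x \ae nu, g x = g' x) ->
  shifts iso_corr f g.
Proof.
move=> h ff gg; apply: (shifts_ae htr h) => //.
- by apply: filterS ff => x ->.
- by apply: filterS gg => x ->.
Qed.

Lemma shifts_L0_exists (f : L0 mu) : exists g : L0 nu, shifts iso_corr f g.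
Proof.
have [g mg fg] := shifts_exists htr (@measurable_funPT _ _ _ _ (f : {mfun A >-> R})).
exists (L0class nu (mfun_Sub (mem_set mg))).
apply: (shifts_classE fg); first exact: aeW.
by apply: filterS (L0classE nu (mfun_Sub (mem_set mg))) => x ->.
Qed.

Lemma shifts_L0_surj (g : L0 nu) : exists f : L0 mu, shifts iso_corr f g.
Proof.
have [f mf fg] := shifts_exists (null_corr_sym htr)
  (@measurable_funPT _ _ _ _ (g : {mfun B >-> R})).
exists (L0class mu (mfun_Sub (mem_set mf))).
apply: (shifts_classE (f' := f) (g' := g) fg); last exact: aeW.
by apply: filterS (L0classE mu (mfun_Sub (mem_set mf))) => x ->.
Qed.

(** The converse implication is [shifts_le] along the inverse correspondence. *)
Lemma shifts_L0_le (f f' : L0 mu) (g g' : L0 nu) :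
  shifts iso_corr f g -> shifts iso_corr f' g' -> (f <= f') <-> (g <= g').
Proof.
move=> h h'; split => /L0_leP H; apply/L0_leP.
- exact: (shifts_le htr h h').
- exact: (shifts_le (null_corr_sym htr) h h').
Qed.

Lemma shifts_L0_uniq (f : L0 mu) (g g' : L0 nu) :
  shifts iso_corr f g -> shifts iso_corr f g' -> g = g'.
Proof.
move=> h h'; apply/eqP; rewrite eq_le.
by apply/andP; split; [apply/(shifts_L0_le h h')|apply/(shifts_L0_le h' h)].
Qed.

Lemma shifts_L0_add (f f' : L0 mu) (g g' : L0 nu) :
  shifts iso_corr f g -> shifts iso_corr f' g' ->
  shifts iso_corr (f + f' : L0 mu) (g + g' : L0 nu).
Proof.
move=> h h'; apply: (shifts_classE (shifts_add htr h h')); exact: L0_DE.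
Qed.

Lemma L0indicE d (T : measurableType d) (m : {measure set T -> \bar R}) (D : malg m) :
  \forall x \ae m, L0indic D x = \1_(val (repr D)) x.
Proof. exact: L0classE. Qed.

Lemma L0projE d (T : measurableType d) (m : {measure set T -> \bar R})
    (D : malg m) (f : L0 m) :
  \forall x \ae m, L0proj D f x = \1_(val (repr D)) x * f x.
Proof. exact: L0classE. Qed.

Lemma shifts_L0proj D (f : L0 mu) (g : L0 nu) : shifts iso_corr f g ->
  shifts iso_corr (L0proj D f) (L0proj (Phi D) g).
Proof.
move=> h; apply: (shifts_classE (shifts_indicM htr (iso_corr_repr D) h)); exact: L0projE.
Qed.

Lemma shifts_L0indic r D :
  shifts iso_corr (r *: L0indic D : L0 mu) (r *: L0indic (Phi D) : L0 nu).
Proof.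
apply: (shifts_classE (shifts_indicM htr (iso_corr_repr D) (shifts_cst htr r))).
- by apply: filterS2 (L0_ZE r (L0indic D)) (L0indicE D) => x -> -> /=; rewrite mulrC.
- by apply: filterS2 (L0_ZE r (L0indic (Phi D))) (L0indicE (Phi D)) => x -> -> /=; rewrite mulrC.
Qed.

Lemma shifts_L0_0 : shifts iso_corr (0 : L0 mu) (0 : L0 nu).
Proof. by apply: (shifts_classE (shifts_cst htr 0)); exact: L0_0E. Qed.

Lemma shift_simple_shifts (u : L0 mu) (v : L0 nu) :
  shift_simple Phi u v -> shifts iso_corr u v.
Proof.
move=> [n [r [E [_ -> _ ->]]]].
elim/big_ind2 : _ => //; first exact: shifts_L0_0.
- by move=> *; exact: shifts_L0_add.
- by move=> i _; exact: shifts_L0indic.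
Qed.

(** The relation [shifts] is an order isomorphism of [L0 mu] onto [L0 nu], so it carries the
    supremum of the [u n] to that of the [v n], and suprema are unique. *)
Lemma shift_sup_shifts (f : L0 mu) (g : L0 nu) :
  shift_sup Phi f g -> shifts iso_corr f g.
Proof.
move=> [u [v [_ uv [fub flub] sg]]].
have [g' fg'] := shifts_L0_exists f.
suff sg' : supremums (range v) g' by rewrite (is_subset1_supremums sg sg').
have {}uv n := shift_simple_shifts (uv n).
split => [_ [n _ <-]|h hub].
  by apply/(shifts_L0_le (uv n) fg'); apply: fub; exists n.
have [k kh] := shifts_L0_surj h.
apply/(shifts_L0_le fg' kh); apply: flub => _ [n _ <-].
by apply/(shifts_L0_le (uv n) kh); apply: hub; exists n.
Qed.

Lemma L0_sumE (I : Type) (s : seq I) (F : I -> L0 mu) :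
  \forall x \ae mu, (\sum_(i <- s) F i : L0 mu) x = \sum_(i <- s) F i x.
Proof.
elim: s => [|i s IH].
  by rewrite big_nil; apply: filterS (L0_0E mu) => x ->; rewrite big_nil.
rewrite big_cons; apply: filterS2 IH (L0_DE (F i) (\sum_(i <- s) F i)) => x IH ->.
by rewrite big_cons IH.
Qed.

Import HBNNSimple.

Lemma nnsfun_shift_simple (h : {nnsfun A >-> R}) (mh : measurable_fun setT h) :
  exists v, shift_simple Phi (L0class mu (mfun_Sub (mem_set mh))) v.
Proof.
have [s0 s0E] := (finite_seqP (range h)).1 (fimfunP h).
(* Removing repetitions makes the level sets attached to distinct indices disjoint. *)
pose s : seq R := undup s0.
have hs x : h x \in s.
  have : [set` s0] (h x) by rewrite -s0E; exists x.
  by rewrite /s mem_undup.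
have mE (i : 'I_(size s)) : measurable (h @^-1` [set s`_i]).
  by rewrite -[X in measurable X]setTI; exact: mh.
pose E i := MSet (mE i).
eexists; exists (size s), (fun i => s`_i), E; split; last by reflexivity.
- move=> i j /negP ij; apply/seteqP; split => // x [/= -> /eqP].
  by rewrite nth_uniq// ?undup_uniq// => /ij.
- apply/L0P.
  have Fi : \forall x \ae mu, forall i : 'I_(size s),
      (s`_i *: L0indic (mclass mu (E i)) : L0 mu) x = s`_i * (h x == s`_i)%:R.
    apply: ae_forall_count => i.
    have := repr_mclass mu (E i).
    apply: filterS3 (L0_ZE s`_i (L0indic (mclass mu (E i))))
      (L0indicE (mclass mu (E i))) => x -> -> /= H.
    rewrite indicE; congr (_ * _%:R); congr nat_of_bool.
    by apply/idP/eqP; rewrite inE => /H.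
  apply: filterS3 Fi (L0classE mu (mfun_Sub (mem_set mh)))
    (L0_sumE (index_enum 'I_(size s)) (fun i => s`_i *: L0indic (mclass mu (E i)))).
  move=> x Fi -> -> /=.
  have i0s : (index (h x) s < size s)%N by rewrite index_mem.
  rewrite (eq_bigr _ (fun i _ => Fi i)) (bigD1 (Ordinal i0s))//= nth_index//.
  rewrite eqxx mulr1 big1 ?addr0// => i /eqP ii0.
  case: eqP => hx; last by rewrite mulr0.
  exfalso; apply: ii0; apply: val_inj => /=.
  by rewrite hx index_uniq// undup_uniq.
- apply/L0_leP; apply: filterS2 (L0_0E mu) (L0classE mu (mfun_Sub (mem_set mh))).
  by move=> x -> -> /=.
Qed.

Lemma shift_sup_exists (f : L0 mu) : 0 <= f -> exists g, shift_sup Phi f g.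
Proof.
move=> f0.
(* The representative of [f] is nonnegative only almost everywhere, whereas [approximation] asks for
   this at every point. *)
pose f' := fun x => Num.max (f x) 0.
have mf' : measurable_fun setT (EFin \o f').
  by apply/measurable_EFinP; apply: measurable_maxr.
have ff' : \forall x \ae mu, f x = f' x.
  move/L0_leP : f0 => f0.
  by apply: filterS2 f0 (L0_0E mu) => x + E; rewrite E /f' => /max_l ->.
have f'0 x : setT x -> (0 <= (EFin \o f') x)%E.
  by move=> _; rewrite lee_fin /f' le_max lexx orbT.
have [h [ndh hf']] := approximation measurableT mf' f'0.
have {}hf' x : h n x @[n --> \oo] --> f' x.
  by have /fine_cvg := hf' x I.
have mh n : measurable_fun setT (h n) by exact: measurable_funPT.
pose u n := L0class mu (mfun_Sub (mem_set (mh n))).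
have uE n : \forall x \ae mu, u n x = h n x by exact: L0classE.
have /choice[v uv] n := nnsfun_shift_simple (mh n).
have [g fg] := shifts_L0_exists f.
exists g, u, v.
have und n : u n <= u n.+1.
  apply/L0_leP; apply: filterS2 (uE n) (uE n.+1) => x -> ->.
  by have /lefP := ndh n n.+1 (leqnSn n); exact.
have sf : supremums (range u) f.
  split => [_ [n _ <-]|k kub].
    apply/L0_leP; apply: filterS2 (uE n) ff' => x -> ->.
    rewrite -(cvg_lim (@Rhausdorff R) (hf' x)).
    apply: (nondecreasing_cvgn_le (u_ := h ^~ x)) => //.
      by move=> a b ab; have /lefP := ndh a b ab; exact.
    by apply/cvg_ex; exists (f' x).
  have /ae_foralln H : forall n, \forall x \ae mu, h n x <= (k : L0 mu) x.
    move=> n; have /L0_leP : u n <= k by apply: kub; exists n.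
    by apply: filterS2 (uE n) => x ->.
  apply/L0_leP; apply: filterS2 ff' H => x -> H.
  rewrite -(cvg_lim (@Rhausdorff R) (hf' x)).
  apply: limr_le; last exact: nearW.
  by apply/cvg_ex; exists (f' x).
split => //.
have {}uv n := shift_simple_shifts (uv n).
case: sf => fub flub; split => [_ [n _ <-]|k kub].
  by apply/(shifts_L0_le (uv n) fg); apply: fub; exists n.
have [l lk] := shifts_L0_surj k.
apply/(shifts_L0_le fg lk); apply: flub => _ [n _ <-].
by apply/(shifts_L0_le (uv n) lk); apply: kub; exists n.
Qed.

(** Existence rules out the default value 0 of [xget]. *)
Lemma shift_operator_posP (f : L0 mu) : 0 <= f ->
  shifts iso_corr f (shift_operator_pos Phi f).
Proof.
move=> /shift_sup_exists[g fg]; rewrite /shift_operator_pos.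
by case: xgetP => [h _ /shift_sup_shifts//|/(_ g)].
Qed.

(** Additivity applied to [f + L0neg f = L0pos f] exhibits the shift of [f] as the difference of the
    shifts of its two parts. *)
Lemma shift_operatorP (f : L0 mu) : shifts iso_corr f (shift_operator Phi f).
Proof.
have [g fg] := shifts_L0_exists f.
have p0 : 0 <= L0pos f by exact: leUr.
have n0 : 0 <= L0neg f by exact: leUr.
have H := shifts_L0_add fg (shift_operator_posP n0).
have fE : f + L0neg f = L0pos f.
  apply/L0P; rewrite /L0neg /L0pos; near=> x.
  rewrite (near (L0_DE f (- f `|` 0)%O) x)//.
  rewrite (near (L0_joinE (- f) 0) x)// (near (L0_joinE f 0) x)//.
  rewrite (near (L0_NE f) x)// (near (L0_0E mu) x)//.
  by rewrite addr_maxr addr0 subrr maxC.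
rewrite fE in H.
have gE := shifts_L0_uniq H (shift_operator_posP p0).
by rewrite /shift_operator -gE addrK.
Unshelve. all: end_near. Qed.

End boolean_isomorphism_corr.

(** * Order projections are multiplications by indicators *)

Section order_projections.
Context (R : realType) d (T : measurableType d) (mu : {measure set T -> \bar R}).
Implicit Types (f g : L0 mu) (D : malg mu).

Definition L0cst (r : R) : L0 mu := L0class mu (cst r : {mfun T >-> R}).

Lemma L0cstE r : \forall x \ae mu, L0cst r x = r.
Proof. exact: L0classE. Qed.

Lemma L0proj_order_projection D : order_projection (@L0proj _ _ _ mu D).
Proof.
split.
- move=> a f g; apply/L0P; near=> x.
  rewrite (near (L0projE D (a *: f + g)) x)// (near (L0_DE (a *: f) g) x)//.
  rewrite (near (L0_DE (a *: L0proj D f) (L0proj D g)) x)//.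
  rewrite (near (L0_ZE a f) x)// (near (L0_ZE a (L0proj D f)) x)//.
  rewrite (near (L0projE D f) x)// (near (L0projE D g) x)//.
  by ring.
- move=> f; apply/L0P; apply: filterS2 (L0projE D f) (L0projE D (L0proj D f)).
  by move=> x E ->; rewrite E indicE; case: (_ \in _); rewrite ?(mul1r, mul0r).
- move=> f /L0_leP f0; apply/andP; split; apply/L0_leP.
  + apply: filterS3 f0 (L0_0E mu) (L0projE D f) => x + E -> => + .
    by rewrite E => fx0; rewrite mulr_ge0// indicE.
  + apply: filterS3 f0 (L0_0E mu) (L0projE D f) => x + E -> => + .
    by rewrite E indicE => fx0; case: (_ \in _); rewrite ?(mul1r, mul0r).
Unshelve. all: end_near. Qed.

(** The image of the constant 1 recovers the indicator function. *)
Lemma L0proj_inj : injective (@L0proj _ _ _ mu).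
Proof.
move=> D D' DD'; rewrite -[D]reprK -[D']reprK; apply/mclassP.
have /L0P : L0proj D (L0cst 1) = L0proj D' (L0cst 1) by rewrite DD'.
move=> H; near=> x.
have : L0proj D (L0cst 1) x = L0proj D' (L0cst 1) x by near: x.
rewrite (near (L0projE D (L0cst 1)) x)// (near (L0projE D' (L0cst 1)) x)//.
rewrite (near (L0cstE 1) x)// !mulr1 !indicE.
rewrite -(in_setE (val (repr D))) -(in_setE (val (repr D'))).
case: (x \in _); case: (x \in _) => //= /eqP; first by rewrite oner_eq0.
by rewrite eq_sym oner_eq0.
Unshelve. all: end_near. Qed.

(* For f >= 0 the element p f /\ (f - p f) is killed by both p and 1 - p, so
   p f is pointwise 0 or f. Comparing the values at f and at f + 1 shows that
   the alternative is decided by p 1 alone. *)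
Lemma order_projectionP (p : L0 mu -> L0 mu) :
  order_projection p -> exists D, p = @L0proj _ _ _ mu D.
Proof.
move=> [plin pp p0].
have pD f g : p (f + g) = p f + p g by rewrite -[f in LHS]scale1r plin scale1r.
have p00 : p 0 = 0.
  by apply/eqP; rewrite eq_le andbC; apply: p0.
have pN f : p (- f) = - p f.
  by apply/eqP; rewrite -addr_eq0 -pD addNr p00.
have pmono f g : f <= g -> p f <= p g.
  move=> fg; have : 0 <= g - f.
    apply/L0_leP; move/L0_leP : fg => fg; near=> x.
    rewrite (near (L0_0E mu) x)// (near (L0_DE g (- f)) x)// (near (L0_NE f) x)//.
    by rewrite subr_ge0; near: x.
  move=> /p0 /andP[+ _]; rewrite pD pN => /L0_leP H; apply/L0_leP; near=> x.
  have : (0 : L0 mu) x <= (p g - p f : L0 mu) x by near: x.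
  rewrite (near (L0_0E mu) x)// (near (L0_DE (p g) (- p f)) x)// (near (L0_NE (p f)) x)//.
  by rewrite subr_ge0.
have pdich f : 0 <= f -> \forall x \ae mu, p f x = 0 \/ p f x = f x.
  move=> f0; have /andP[pf0 pff] := p0 _ f0.
  pose h : L0 mu := (p f `&` (f - p f))%O.
  have h0 : 0 <= h.
    rewrite lexI pf0 /=; apply/L0_leP; move/L0_leP : pff => pff; near=> x.
    rewrite (near (L0_0E mu) x)// (near (L0_DE f (- p f)) x)// (near (L0_NE (p f)) x)//.
    by rewrite subr_ge0; near: x.
  have ph0 : p h = 0.
    apply/eqP; rewrite eq_le; have /andP[-> _] := p0 _ h0; rewrite andbT.
    have -> : 0 = p (f - p f) by rewrite pD pN pp subrr.
    by apply: pmono; exact: leIr.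
  have h00 : h = 0.
    apply/eqP; rewrite eq_le h0 andbT.
    (* The bound [p g <= g] for [g = p f - h] reads [p f <= p f - h], since [p h = 0]; hence
       [h <= 0]. *)
    have : 0 <= p f - h.
      have : h <= p f by exact: leIl.
      move=> /L0_leP hpf; apply/L0_leP; near=> x.
      rewrite (near (L0_0E mu) x)// (near (L0_DE (p f) (- h)) x)// (near (L0_NE h) x)//.
      by rewrite subr_ge0; near: x.
    move=> /p0 /andP[_]; rewrite pD pN pp ph0 subr0.
    move=> /L0_leP H; apply/L0_leP; near=> x.
    have : p f x <= (p f - h : L0 mu) x by near: x.
    rewrite (near (L0_DE (p f) (- h)) x)// (near (L0_NE h) x)// (near (L0_0E mu) x)//.
    by rewrite lerBrDr gerDl.
  have /L0P H := h00.
  near=> x.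
  have : Num.min (p f x) (f x - p f x) = 0.
    rewrite -(near (L0_0E mu) x)// -(near H x)// /h.
    rewrite (near (L0_meetE (p f) (f - p f)) x)//.
    by rewrite (near (L0_DE f (- p f)) x)// (near (L0_NE (p f)) x).
  rewrite /Order.min; case: ifP => _ E; first by left.
  by right; apply/esym/eqP; rewrite -subr_eq0 E.
(* Here [a], [e], [t] stand for the values of [p f'], [p one] and [f'] at a point. In the two mixed
   cases, the dichotomy for [f' + one] forces [t = 0]. *)
have dich (a e t : R) : a = 0 \/ a = t -> e = 0 \/ e = 1 ->
    a + e = 0 \/ a + e = t + 1 -> a <= t -> 0 <= t -> a = (0 < e)%R%:R * t.
  clear; move=> e1 [] ->; rewrite ?ltxx ?ltr01 ?mul0r ?mul1r;
    by case: e1 => // e1; case=> e3; lra.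
have maxB (a : R) : a = Num.max a 0 - Num.max (- a) 0.
  by clear; rewrite /Order.max; case: ltP => ?; case: ltP => ?; lra.
pose one := L0cst 1.
have one0 : 0 <= one.
  by apply/L0_leP; apply: filterS2 (L0_0E mu) (L0cstE 1) => x -> ->.
have mD : measurable [set x | 0 < p one x].
  by apply: measurable_gtr; exact: measurable_funPT.
exists (mclass mu (MSet mD)); apply/funext => f.
have pos f' : 0 <= f' -> p f' = L0proj (mclass mu (MSet mD)) f'.
  move=> f0; apply/L0P.
  have f10 : 0 <= f' + one.
    apply/L0_leP; move/L0_leP : f0 => f0'; near=> x.
    have f'x0 : 0 <= f' x by rewrite -(near (L0_0E mu) x)//; near: x.
    rewrite (near (L0_0E mu) x)// (near (L0_DE f' one) x)// (near (L0cstE 1) x)//.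
    by rewrite addr_ge0.
  have H1 := pdich _ f0; have H2 := pdich _ one0; have H3 := pdich _ f10.
  have /andP[_ /L0_leP pff] := p0 _ f0.
  move/L0_leP : (f0) => f0'.
  near=> x.
  rewrite (near (L0projE (mclass mu (MSet mD)) f') x)// indicE.
  have -> : (x \in val (repr (mclass mu (MSet mD)))) = (0 < p one x).
    have Hr : val (repr (mclass mu (MSet mD))) x <-> 0 < p one x by near: x; exact: repr_mclass.
    by apply/idP/idP; rewrite inE => h; apply/Hr.
  have e1 : p f' x = 0 \/ p f' x = f' x by near: x.
  have e2 : p one x = 0 \/ p one x = 1.
    by rewrite -[X in _ \/ _ = X](near (L0cstE 1) x)//; near: x.
  have e3 : p f' x + p one x = 0 \/ p f' x + p one x = f' x + 1.
    rewrite -[X in _ \/ _ = _ + X](near (L0cstE 1) x)//.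
    rewrite -(near (L0_DE f' one) x)// -(near (L0_DE (p f') (p one)) x)// -pD.
    by near: x.
  have e4 : p f' x <= f' x by near: x.
  have e5 : 0 <= f' x by rewrite -(near (L0_0E mu) x)//; near: x.
  exact: dich.
have fE : f = L0pos f - L0neg f.
  apply/L0P; rewrite /L0neg /L0pos; near=> x.
  rewrite (near (L0_DE (f `|` 0)%O (- (- f `|` 0)%O)) x)//.
  rewrite (near (L0_NE (- f `|` 0)%O) x)//.
  rewrite (near (L0_joinE (- f) 0) x)// (near (L0_joinE f 0) x)//.
  rewrite (near (L0_NE f) x)// (near (L0_0E mu) x)//.
have [qlin _ _] := L0proj_order_projection (mclass mu (MSet mD)).
transitivity (p (L0pos f - L0neg f)); first by rewrite -fE.
transitivity (L0proj (mclass mu (MSet mD)) (L0pos f - L0neg f)); last by rewrite -fE.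
have f1 : 0 <= L0pos f by exact: leUr.
have f2 : 0 <= L0neg f by exact: leUr.
by rewrite addrC -scaleN1r plin qlin (pos _ f1) (pos _ f2).
Unshelve. all: end_near. Qed.

Lemma proj_classK D : proj_class (@L0proj _ _ _ mu D) = D.
Proof.
by rewrite /proj_class; case: xgetP => [D' _ /= /L0proj_inj//|/(_ D) []].
Qed.

End order_projections.

(** * Cluster points and measurable selection of an index *)

Lemma invSn_lt (R : realType) (e : R) : 0 < e -> exists m : nat, m.+1%:R^-1 < e.
Proof.
move=> e0; have [k] := ltr_add_invr e0; rewrite add0r; by exists k.
Qed.

(** The suprema of the tails decrease to the upper limit, and each tail has a term close to its
    supremum. The upper limit thus serves as a cluster point that depends measurably on
    parameters. *)
Lemma limn_sup_cluster (R : realType) (w : nat -> R) (K : R) :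
  (forall n, `|w n| <= K) -> forall (e : R) (k : nat), 0 < e ->
  exists n, (k <= n)%N /\ `|w n - limn_sup w| < e.
Proof.
move=> wK e k e0.
have ub : has_ubound (range w).
  by exists K => _ [n _ <-]; rewrite (le_trans (ler_norm _)).
have lb : has_lbound (range w).
  by exists (- K) => _ [n _ <-]; rewrite lerNl (le_trans (ler_norm _))// normrN.
have cw := cvg_sups_inf ub lb.
have -> : limn_sup w = inf (range (sups w)) by exact: cvg_lim.
set L := inf _ in cw *.
have [k0 _ K0] : \forall n \near \oo, `|L - sups w n| < e.
  by move/cvgrPdist_lt : cw; exact.
pose k1 := maxn k k0.
have := K0 k1 (leq_maxr _ _); rewrite /= ltr_norml => /andP[h1 h2].
have sLe : L <= sups w k1.
  apply: ge_inf; last by exists k1.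
  exists (- K) => _ [n _ <-].
  apply: (@le_trans _ _ (w n)); first by rewrite lerNl (le_trans (ler_norm _))// normrN.
  by apply: ub_le_sup; [exact: has_ubound_sdrop|exists n => /=].
have [||_ [n /= kn <-] wn] := @sup_gt _ (sdrop w k1) (L - e).
- by exists (w k1), k1 => /=.
- by apply: lt_le_trans sLe; rewrite gtrBl.
exists n; split; first exact: leq_trans (leq_maxl _ _) kn.
have : w n <= sups w k1.
  by apply: ub_le_sup; [exact: has_ubound_sdrop|exists n].
move=> wns; rewrite ltr_norml; apply/andP; split; lra.
Qed.

Section countable_selection.
Context (R : realType) d (T : measurableType d) (I : countType).

(** [J x] is the index of least code among those [i] with [P i x]. The sets [E i] where [i] is that
    index are measurable and disjoint; [i0] is the value at the points lying in no [P i]. *)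
Lemma countable_selection (i0 : I) (P : I -> set T) :
  (forall i, measurable (P i)) ->
  exists J : T -> I, (forall i, measurable [set x | J x = i]) /\
    forall x, P (J x) x \/ (J x = i0 /\ forall i, ~ P i x).
Proof.
move=> mP.
pose E i := P i `\` \bigcup_(j in [set j | (pickle j < pickle i)%N]) P j.
have mcup (Q : set I) : measurable (\bigcup_(j in Q) P j).
  rewrite [X in measurable X](_ : _ =
      \bigcup_n (if unpickle n is Some j then (if j \in Q then P j else set0) else set0)).
    apply: bigcupT_measurable => n.
    by case: (unpickle n) => [j|]//; case: ifP.
  apply/seteqP; split => x.
    by move=> [j Qj Pj]; exists (pickle j) => //; rewrite pickleK mem_set.
  move=> [n _]; case: (unpickle n) => [j|]//; case: ifPn => // jQ Pj.
  by exists j => //; exact/set_mem.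
have mE i : measurable (E i) by apply: measurableD.
have Euniq x i j : E i x -> E j x -> i = j.
  move=> [Pi Ni] [Pj Nj]; case: (ltngtP (pickle i) (pickle j)) => [ij|ji|/(pcan_inj pickleK)//].
  - by exfalso; apply: Nj; exists i.
  - by exfalso; apply: Ni; exists j.
have Eex x i : P i x -> exists j, E j x.
  move=> Pi; have ex : exists n, `[< exists j, pickle j = n /\ P j x >].
    by exists (pickle i); apply/asboolP; exists i.
  case: (ex_minnP ex) => n /asboolP[j [jn Pj]] nmin; exists j; split => // -[l /= lj Pl].
  have : (n <= pickle l)%N by apply: nmin; apply/asboolP; exists l.
  by rewrite leqNgt -jn lj.
pose J x := xget i0 [set i | E i x].
have JE x i : P i x -> E (J x) x.
  move=> /Eex[j Ej]; rewrite /J; case: xgetP => [l _ //|/(_ j) []//].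
exists J; split => [i|x]; last first.
  have [[i /JE[]]|nP] := pselect (exists i, P i x); first by left.
  right; split; last by move=> i Pi; apply: nP; exists i.
  by rewrite /J; case: xgetP => // l _ [Pl _]; exfalso; apply: nP; exists l.
rewrite (_ : [set x | J x = i] = E i `|`
    ((if i == i0 then setT else set0) `\` \bigcup_(j in setT) P j)).
  by apply: measurableU => //; apply: measurableD => //; case: ifP.
apply/seteqP; split => x /=.
- move=> Ji; have [[j Pj]|nP] := pselect (exists j, P j x).
    by left; rewrite -Ji; exact: JE Pj.
  right; split; last by move=> [j _ Pj]; apply: nP; exists j.
  rewrite -Ji /J; case: xgetP => [l _ [Pl _]|_]; last by rewrite eqxx.
  by exfalso; apply: nP; exists l.
- move=> [Ei|[ii0 nP]].
    by apply: (Euniq x _ _ _ Ei); apply: (JE x i); case: Ei.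
  rewrite /J; case: xgetP => [l _ [Pl _]|_]; first by exfalso; apply: nP; exists l.
  by move: ii0; case: ifPn => [/eqP//|].
Qed.

Lemma measurable_fun_countable_glue (J : T -> I) (h : I -> T -> R) :
  (forall i, measurable [set x | J x = i]) ->
  (forall i, measurable_fun setT (h i)) ->
  measurable_fun setT (fun x => h (J x) x).
Proof.
move=> mJ mh _ Y mY; rewrite setTI.
rewrite [X in measurable X](_ : _ = \bigcup_n (if unpickle n is Some j
    then [set x | J x = j] `&` (h j @^-1` Y) else set0)).
  apply: bigcupT_measurable => n; case: (unpickle n) => [j|]//.
  by apply: measurableI => //; rewrite -[X in measurable X]setTI; exact: mh.
apply/seteqP; split => x /=.
  by move=> hY; exists (pickle (J x)) => //; rewrite pickleK.
by move=> [n _]; case: (unpickle n) => // j [/= <-].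
Qed.

End countable_selection.

(** * Extension by continuity from the rationals to the reals *)

Section rational_limits.
Variable R : realType.
Implicit Types (G : rat -> R).

(** The limit is not punctured: if [r] is itself the rational [q], then [l] must be [G q]. *)
Definition rat_cvg G (r l : R) := forall e : R, 0 < e -> exists2 d : R, 0 < d &
  forall q : rat, `|ratr q - r| < d -> `|G q - l| < e.

Definition rat_unif_cont G := forall (K : nat) (e : R), 0 < e ->
  exists2 d : R, 0 < d & forall p q : rat, `|ratr p| <= K%:R :> R ->
    `|ratr q| <= K%:R :> R -> `|ratr p - ratr q| < d -> `|G p - G q| < e.

Lemma rat_cvg_seq G r l (q : nat -> rat) : rat_cvg G r l ->
  (forall n, `|ratr (q n) - r| < n.+1%:R^-1) -> G (q n) @[n --> \oo] --> l.
Proof.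
move=> Gl qr; apply/cvgrPdist_lt => e e0; have [d d0 H] := Gl e e0.
have [m md] := invSn_lt d0; exists m => // n /= mn; rewrite distrC; apply: H.
apply: lt_trans (qr n) (le_lt_trans _ md).
by rewrite lef_pV2 ?posrE// ler_nat ltnS.
Qed.

Lemma rat_approx (r : R) : exists q : nat -> rat,
  forall n, `|ratr (q n) - r| < n.+1%:R^-1.
Proof.
suff /choice[q qr] : forall n : nat, exists q : rat, `|ratr q - r| < n.+1%:R^-1 by exists q.
move=> n.
have [|q /andP[q1 q2]] := @rat_between R (r - n.+1%:R^-1) (r + n.+1%:R^-1).
  by rewrite ltrBlDr -addrA ltrDl addr_gt0// invr_gt0.
by exists q; rewrite ltr_distl q1 q2.
Qed.

Lemma rat_cvg_uniq G r l l' : rat_cvg G r l -> rat_cvg G r l' -> l = l'.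
Proof.
move=> h h'; have [q qr] := rat_approx r.
exact: (cvg_unique (@Rhausdorff R) (rat_cvg_seq h qr) (rat_cvg_seq h' qr)).
Qed.

(** For [t] near [r], a rational sufficiently close to [t] has a value under [G] that is close both
    to [M t] and to [M r]. *)
Lemma rat_cvg_continuous G (M : R -> R) :
  (forall r, rat_cvg G r (M r)) -> continuous M.
Proof.
move=> GM r; apply/cvgrPdist_lt => e e0.
have e20 : 0 < e / 2 by rewrite divr_gt0.
have [d d0 H] := GM r _ e20.
exists (d / 2) => /=; first by rewrite divr_gt0.
move=> t /= rt.
have [d' d'0 H'] := GM t _ e20.
pose d1 := Num.min (d / 2) d'.
have d10 : 0 < d1 by rewrite /d1 lt_min divr_gt0.
have [m md] := invSn_lt d10.
have [q qt] := rat_approx t.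
have qd1 : `|ratr (q m) - t| < d1 := lt_trans (qt m) md.
move: qd1; rewrite /d1 lt_min => /andP[qd qd'].
have := H' _ qd'.
have : `|ratr (q m) - r| < d.
  rewrite (_ : _ - r = (ratr (q m) - t) + (t - r)); last by ring.
  rewrite (le_lt_trans (ler_normD _ _))//.
  by rewrite [ltRHS](splitr d) ltrD// distrC.
move=> /H h1 h2.
rewrite (_ : M r - M t = - (G (q m) - M r) + (G (q m) - M t)); last by ring.
rewrite (le_lt_trans (ler_normD _ _))//.
by rewrite [ltRHS](splitr e) ltrD// normrN.
Qed.

Lemma rat_unif_cont_cvg G r : rat_unif_cont G -> exists l, rat_cvg G r l.
Proof.
move=> Gu; have [q qr] := rat_approx r.
(* The second successor leaves room for every rational within distance 1 of [r]; this is also why 1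
   enters the final radius. *)
pose K := (truncn `|r|).+2.
have Kr : `|r| + 1 <= K%:R.
  by rewrite -natr1 lerD2r; apply/ltW/truncnS_gt.
have qK p : `|ratr p - r| <= 1 -> `|ratr p| <= K%:R :> R.
  move=> pr; rewrite -[X in `|X|](subrK r) (le_trans (ler_normD _ _))//.
  by rewrite (le_trans _ Kr)// addrC lerD2l.
have qnK n : `|ratr (q n)| <= K%:R :> R.
  apply: qK; rewrite (le_trans (ltW (qr n)))// invf_le1// ler1n//.
have near_q d : 0 < d -> exists m, forall n p, (m <= n)%N -> `|ratr p - r| < d / 2 ->
    `|ratr p - ratr (q n)| < d.
  move=> d0; have [m md] := invSn_lt (divr_gt0 d0 (ltr0n R 2)).
  exists m => n p mn pr.
  rewrite (_ : _ - ratr (q n) = (ratr p - r) - (ratr (q n) - r)); last by ring.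
  rewrite (le_lt_trans (ler_normB _ _))// [ltRHS](splitr d) ltrD//.
  apply: lt_trans (qr n) (le_lt_trans _ md).
  by rewrite lef_pV2 ?posrE// ler_nat ltnS.
have qn_near d : 0 < d -> exists m, forall n, (m <= n)%N -> `|ratr (q n) - r| < d / 2.
  move=> d0; have [m md] := invSn_lt (divr_gt0 d0 (ltr0n R 2)).
  exists m => n mn; apply: lt_trans (qr n) (le_lt_trans _ md).
  by rewrite lef_pV2 ?posrE// ler_nat ltnS.
have : cvgn (fun n => G (q n)).
  apply: cauchy_cvg; apply: cauchy_exP => e e0.
  have [d d0 H] := Gu K e e0.
  have [m Hm] := near_q d d0; have [m' Hm'] := qn_near d d0.
  pose k := maxn m m'.
  exists (G (q k)); exists k => // n /= kn.
  rewrite /ball /=; apply: H => //; apply: Hm; last exact/Hm'/leq_maxr.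
  exact: leq_trans (leq_maxl _ _) kn.
move=> /cvg_ex[/= l Gl]; exists l => e e0.
have e20 : 0 < e / 2 by rewrite divr_gt0.
have [d d0 H] := Gu K _ e20.
have [m Hm] := near_q d d0.
exists (Num.min (d / 2) 1); first by rewrite lt_min divr_gt0//=.
move=> p; rewrite lt_min => /andP[pd p1].
have [m' _ Hm'] : \forall n \near \oo, `|l - G (q n)| < e / 2.
  by move/cvgrPdist_lt : Gl; exact.
pose k := maxn m m'.
have h1 : `|G p - G (q k)| < e / 2.
  by apply: H => //; [exact/qK/ltW|apply: Hm => //; exact: leq_maxl].
have h2 : `|l - G (q k)| < e / 2 by apply: Hm'; exact: leq_maxr.
rewrite (_ : G p - l = (G p - G (q k)) - (l - G (q k))); last by ring.
by rewrite (le_lt_trans (ler_normB _ _))// [ltRHS](splitr e) ltrD.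
Qed.

End rational_limits.

(** * Continuous operators commuting with indicators are superpositions *)

Section local_operators.
Context (R : realType) d (B : measurableType d).
Variables (nu : {measure set B -> \bar R}) (lnu : {finite_measure set B -> \bar R}).
Hypothesis hnu : same_null_sets nu lnu.
Variable V : L0 nu -> L0 nu.
Hypothesis V_local : forall D u, V (L0proj D u) = L0proj D (V u).
Hypothesis V_cont : forall (u : L0 nu) (u_ : nat -> L0 nu),
  (\forall s \ae nu, u_ n s @[n --> \oo] --> u s) ->
  rho lnu (V u) (V (u_ n)) @[n --> \oo] --> (0 : R).

(** Functions that agree on [E] have the same projection onto [E], so their images have the same
    projection as well. *)
Lemma local_eq (E : set B) (u v : L0 nu) : measurable E ->
  (\forall s \ae nu, E s -> u s = v s) ->
  \forall s \ae nu, E s -> V u s = V v s.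
Proof.
move=> mE uv; pose D := mclass nu (MSet mE).
have projE (w : L0 nu) : \forall s \ae nu, E s -> L0proj D w s = w s.
  apply: filterS2 (L0projE D w) (repr_mclass nu (MSet mE)) => s -> H Es.
  by rewrite indicE mem_set ?mul1r//; apply/H.
have /(congr1 V) : L0proj D u = L0proj D v.
  apply/L0P; apply: filterS (filterI (filterI (L0projE D u) (L0projE D v))
    (filterI uv (repr_mclass nu (MSet mE)))) => s [[-> ->] [uvs H]].
  rewrite indicE; case: (boolP (s \in _)) => [/set_mem sD|]; last by rewrite !mul0r.
  by rewrite uvs//; apply/H.
rewrite !V_local => /L0P VD.
apply: filterS3 VD (projE (V u)) (projE (V v)) => s H h1 h2 Es.
by rewrite -h1// -h2.
Qed.

(** The projection attached to the null class sends everything to 0. *)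
Lemma local0 : V 0 = 0.
Proof.
pose D := mclass nu (mset0 B).
have P0 (w : L0 nu) : L0proj D w = 0.
  apply/L0P; apply: filterS3 (L0projE D w) (repr_mclass nu (mset0 B)) (L0_0E nu).
  move=> s -> H ->; rewrite indicE; case: (boolP (s \in _)) => [/set_mem/H[]|_].
  by rewrite mul0r.
by rewrite -[in LHS](P0 0) V_local P0.
Qed.

(** Only countably many constants are used, so the exceptional null sets of their images can be
    united. *)
Definition rat_values (s : B) (q : rat) : R := V (L0cst nu (ratr q)) s.

Let mrat_values q : measurable_fun setT (rat_values ^~ q).
Proof. exact: measurable_funPT. Qed.

(* If the conclusion failed on a set of positive measure, a measurable choice
   of bad rationals would give functions tending to u whose images under V
   stay away from V u there. *)
Lemma rat_values_cvg (u : L0 nu) :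
  \forall s \ae nu, rat_cvg (rat_values s) (u s) (V u s).
Proof.
pose bad (m n : nat) (q : rat) : set B :=
  [set s | `|ratr q - u s| < n.+1%:R^-1 /\ m.+1%:R^-1 < `|rat_values s q - V u s|].
have mbad m n q : measurable (bad m n q).
  apply: measurableI; last first.
    apply: measurable_gtr; apply: measurableT_comp => //.
    by apply: measurable_funB => //; exact: measurable_funPT.
  rewrite [X in measurable X](_ : _ = [set s | - n.+1%:R^-1 < - `|ratr q - u s|]).
    apply: measurable_gtr; apply: measurableT_comp => //.
    by apply: measurableT_comp => //; apply: measurable_funB.
  by apply/seteqP; split => s /=; rewrite ltrN2.
suff H m : \forall s \ae nu, ~ forall n, exists q, bad m n q s.
  have := ae_foralln H; apply: filterS => s Hs e e0.
  have [m me] := invSn_lt e0; have /existsNP[n Hn] := Hs m.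
  exists n.+1%:R^-1; first by rewrite invr_gt0.
  move=> q qn; apply: le_lt_trans me; rewrite leNgt; apply/negP => h.
  by apply: Hn; exists q.
(* [None] marks the points without a bad rational. There the selected function takes the value of
   [u] itself, so the selected functions converge to [u] wherever their representatives agree with
   the selection. *)
pose P n (o : option rat) : set B := if o is Some q then bad m n q else set0.
have /choice[J JP] : forall n, exists J : B -> option rat,
    (forall i, measurable [set x | J x = i]) /\
    forall x, P n (J x) x \/ (J x = None /\ forall i, ~ P n i x).
  by move=> n; apply: countable_selection => -[q|]//=; exact: mbad.
pose h (o : option rat) (s : B) : R := if o is Some q then ratr q else u s.
have mh n : measurable_fun setT (fun s => h (J n s) s).
  apply: measurable_fun_countable_glue; first exact: (JP n).1.
  by case=> [q|] /=; [exact: measurable_cst|exact: measurable_funPT].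
pose u_ n := L0class nu (mfun_Sub (mem_set (mh n))).
have u_E : \forall s \ae nu, forall n, u_ n s = h (J n s) s.
  by apply: ae_foralln => n; exact: L0classE.
have u_u : \forall s \ae nu, u_ n s @[n --> \oo] --> u s.
  apply: filterS u_E => s u_E; apply/cvgrPdist_lt => e e0.
  have [k ke] := invSn_lt e0; exists k => // n /= kn; rewrite u_E.
  have := (JP n).2 s; rewrite /h; case: (J n s) => [q|]; last by rewrite subrr normr0.
  case=> [[qu _]|[]//]; rewrite distrC; apply: lt_trans qu (le_lt_trans _ ke).
  by rewrite lef_pV2 ?posrE// ler_nat ltnS.
have Vu_ : \forall s \ae nu, forall n q, J n s = Some q -> V (u_ n) s = rat_values s q.
  apply: ae_foralln => n; apply: ae_forall_count => q.
  apply: (local_eq ((JP n).1 (Some q))).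
  apply: filterS2 u_E (L0cstE nu (ratr q)) => s u_E -> /= Jq.
  by rewrite u_E Jq.
(* Convergence in [rho] only gives almost everywhere convergence along rapidly convergent indices.
   This suffices, since under [bads] a bad rational is available at every index. *)
have /choice[k kP] : forall j : nat, exists k, rho lnu (V u) (V (u_ k)) < 2 ^- j.+1.
  move=> j; have j0 : 0 < 2 ^- j.+1 :> R by rewrite invr_gt0 exprn_gt0.
  have /cvgr0Pnorm_lt/(_ _ j0)[n _ /(_ n (leqnn n))/= H] := V_cont u_u.
  by exists n; apply: le_lt_trans (ler_norm _) H.
have := rho_fast_ae_cvg hnu kP.
apply: filterS2 Vu_ => s Vu_ cVu bads.
have m0 : 0 < m.+1%:R^-1 :> R by rewrite invr_gt0.
move/cvgrPdist_lt : cVu => /(_ _ m0)[n _ /(_ n (leqnn n))/=].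
have [q badq] := bads (k n).
have := (JP (k n)).2 s; move JE : (J (k n) s) => o; case: o JE => [q'|] JE.
  case=> [[_ bad2]|[]//]; rewrite (Vu_ _ _ JE) distrC => /(lt_trans bad2).
  by rewrite ltxx.
by case=> [//|[_ /(_ (Some q))]].
Qed.

(* A cluster point of the bad rationals, chosen measurably as their upper limit,
   contradicts rat_values_cvg. *)
Lemma rat_values_unif_cont : \forall s \ae nu, rat_unif_cont (rat_values s).
Proof.
pose bad (K m n : nat) (pq : rat * rat) : set B :=
  [set s | [/\ `|ratr pq.1| <= K%:R :> R, `|ratr pq.2| <= K%:R :> R &
     `|ratr pq.1 - ratr pq.2| < n.+1%:R^-1 :> R] /\
     m.+1%:R^-1 < `|rat_values s pq.1 - rat_values s pq.2|].
have mbad K m n pq : measurable (bad K m n pq).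
  apply: measurableI; last first.
    apply: measurable_gtr; apply: measurableT_comp => //.
    by apply: measurable_funB.
  have [q|q] := pselect [/\ `|ratr pq.1| <= K%:R :> R, `|ratr pq.2| <= K%:R :> R &
      `|ratr pq.1 - ratr pq.2| < n.+1%:R^-1 :> R].
    by rewrite [X in measurable X](_ : _ = setT)//; apply/seteqP; split.
  by rewrite [X in measurable X](_ : _ = set0)//; apply/seteqP; split.
suff H K m : \forall s \ae nu, ~ forall n, exists pq, bad K m n pq s.
  have := ae_foralln (fun K => ae_foralln (H K)); apply: filterS => s Hs K e e0.
  have [m me] := invSn_lt e0; have /existsNP[n Hn] := Hs K m.
  exists n.+1%:R^-1; first by rewrite invr_gt0.
  move=> p q pK qK pqn; apply: le_lt_trans me; rewrite leNgt; apply/negP => h.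
  by apply: Hn; exists (p, q).
have /choice[J JP] : forall n, exists J : B -> rat * rat,
    (forall i, measurable [set x | J x = i]) /\
    forall x, bad K m n (J x) x \/ (J x = (0, 0) /\ forall i, ~ bad K m n i x).
  by move=> n; apply: countable_selection => pq; exact: mbad.
(* The test keeps [w] bounded by [K] at every point, as the upper limit requires. *)
pose h (pq : rat * rat) (s : B) : R := if `|ratr pq.1| <= K%:R :> R then ratr pq.1 else 0.
pose w n s := h (J n s) s.
have wK s n : `|w n s| <= K%:R by rewrite /w /h; case: ifP => //; rewrite normr0.
have mw n : measurable_fun setT (w n).
  apply: measurable_fun_countable_glue; first exact: (JP n).1.
  by move=> pq; exact: measurable_cst.
have mu : measurable_fun setT (fun s => limn_sup (w ^~ s)).
  apply: measurable_fun_limn_sup => // s _.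
  - by exists K%:R => _ [n _ <-]; rewrite (le_trans (ler_norm _)).
  - by exists (- K%:R) => _ [n _ <-]; rewrite lerNl (le_trans (ler_norm _))// normrN.
pose u := L0class nu (mfun_Sub (mem_set mu)).
have uE : \forall s \ae nu, u s = limn_sup (w ^~ s) by exact: L0classE.
apply: filterS2 uE (rat_values_cvg u) => s -> cvgs bads.
(* The first rational of the pair is within [eta / 2] of the upper limit and the two differ by less
   than [eta / 2]. Both then satisfy the estimate from [cvgs], and the two errors below [e]
   contradict the gap [m.+1%:R^-1]. *)
pose e : R := m.+1%:R^-1 / 2.
have e0 : 0 < e by rewrite divr_gt0// invr_gt0.
have [eta eta0 Hd] := cvgs e e0.
have d20 : 0 < eta / 2 by rewrite divr_gt0.
have [k kd] := invSn_lt d20.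
have [n [kn wn]] := limn_sup_cluster (wK s) k d20.
have [pq badpq] := bads n.
case: ((JP n).2 s) => [[[pK qK pqn] bad2]|[_ /(_ pq)//]].
rewrite /w /h pK in wn.
have := Hd _ (lt_trans wn _); rewrite {1}[X in _ < X](splitr eta) ltrDl => /(_ d20) h1.
have : `|ratr (J n s).2 - limn_sup (w^~ s)| < eta.
  rewrite (_ : _ - _ = (ratr (J n s).1 - limn_sup (w^~ s))
    - (ratr (J n s).1 - ratr (J n s).2)); last by ring.
  rewrite (le_lt_trans (ler_normB _ _))// [ltRHS](splitr eta) ltrD//.
  apply: lt_trans pqn (le_lt_trans _ kd).
  by rewrite lef_pV2 ?posrE// ler_nat ltnS.
move=> /Hd h2; move: bad2.
rewrite (_ : rat_values s (J n s).1 - _ = (rat_values s (J n s).1 - V u s)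
    - (rat_values s (J n s).2 - V u s)); last by ring.
rewrite ltNge => /negP; apply; apply/ltW.
by rewrite (le_lt_trans (ler_normB _ _))// [ltRHS]splitr ltrD.
Qed.

Lemma local_superposition : exists N : B -> R -> R, K_function nu N /\
  forall u : L0 nu, \forall s \ae nu, V u s = N s (u s).
Proof.
have [E [mE E0 goodE]] := rat_values_unif_cont.
have good s : s \notin E -> rat_unif_cont (rat_values s).
  by move=> sE; apply: contrapT => ns; move/negP : sE; apply; apply/mem_set/goodE.
have /choice[q qr] := @rat_approx R.
(* The approximating rationals [q r] do not depend on [s], which makes [N ^~ r] a pointwise limit of
   measurable functions. The value 0 on [E] secures the limit at every point. *)
pose N s r := if s \in E then 0 else limn (fun n => rat_values s (q r n)).
have NP s r : s \notin E -> rat_cvg (rat_values s) r (N s r).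
  move=> sE; have [l lr] := rat_unif_cont_cvg r (good s sE).
  by rewrite /N (negbTE sE) (cvg_lim (@Rhausdorff R) (rat_cvg_seq lr (qr r))).
have aeE : \forall s \ae nu, s \notin E.
  by exists E; split => // s /= /negP; rewrite negbK => /set_mem.
have VN (u : L0 nu) : \forall s \ae nu, V u s = N s (u s).
  apply: filterS2 aeE (rat_values_cvg u) => s sE H.
  exact: rat_cvg_uniq H (NP s (u s) sE).
exists N; split => //; split.
- have := VN 0; rewrite local0.
  by apply: filterS2 (L0_0E nu) => s ->.
- move=> r; apply: (@measurable_fun_cvg _ _ _ _
    (fun n s => if s \in E then 0 else rat_values s (q r n))).
    move=> n; apply: measurable_fun_ifT => //.
    by apply: (measurable_fun_bool true); rewrite setTI preimage_mem_true.
  move=> s _; rewrite /N; case: ifPn => sE; first exact: cvg_cst.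
  have := NP s r sE; rewrite /N (negbTE sE) => H.
  exact: rat_cvg_seq H (qr r).
- by apply: filterS aeE => s sE; apply: rat_cvg_continuous => r; exact: NP.
Qed.

End local_operators.

(** * Continuous atomic operators as superpositions after a shift *)

Theorem theorem3p2 (R : realType)
    (dA : measure_display) (A : measurableType dA)
    (dB : measure_display) (B : measurableType dB)
    (mu : {sigma_finite_measure set A -> \bar R})
    (nu : {sigma_finite_measure set B -> \bar R})
    (lambda_mu : {finite_measure set A -> \bar R})
    (lambda_nu : {finite_measure set B -> \bar R})
    (hmu : same_null_sets mu lambda_mu)
    (hnu : same_null_sets nu lambda_nu)
    (Phi : malg mu -> malg nu) (hPhi : boolean_isomorphism Phi)
    (T : L0 mu -> L0 nu)
    (hT : orthogonally_additive T) (hTreg : regular_operator T) :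
  (rho_continuous lambda_mu lambda_nu T /\ atomic_subordinate Phi T)
  <->
  (exists N : B -> R -> R,
     K_function nu N /\ T = superposition N \o shift_operator Phi).
Proof.
have htr := iso_corrP hPhi; have SP := shift_operatorP hPhi.
split=> [[Tc Ta]|[N [KN ->]]].
(* [S'] is the inverse of the shift operator; the local operator to be represented is [T \o S']. *)
- have /choice[S' S'P] := shifts_L0_surj hPhi.
  have S'uniq (f f' : L0 mu) (g : L0 nu) :
      shifts (iso_corr Phi) f g -> shifts (iso_corr Phi) f' g -> f = f'.
    move=> h h'; apply/eqP; rewrite eq_le; apply/andP; split.
    + exact/(shifts_L0_le hPhi h h').
    + exact/(shifts_L0_le hPhi h' h).
  have S'K f : S' (shift_operator Phi f) = f by exact: S'uniq (S'P _) (SP f).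
  have [] := @local_superposition R dB B nu lambda_nu hnu (T \o S').
  (* Every class [D] is some [Phi C], and [S'] turns [L0proj (Phi C)] into [L0proj C]. Subordination
     of [T] to [Phi] thereby becomes locality of [T \o S']. *)
  + move=> D u; have [C <-] := iso_surj hPhi D => /=.
    rewrite -(S'uniq _ _ _ (shifts_L0proj hPhi C (S'P u)) (S'P _)).
    have := congr1 (@^~ (S' u)) (Ta _ (L0proj_order_projection C)).
    by rewrite /= /Phi_proj proj_classK.
  + move=> u u_ u_u.
    have S'u : \forall x \ae mu, S' (u_ n) x @[n --> \oo] --> S' u x.
      exact: (shifts_cvg (null_corr_sym htr) (fun n => S'P (u_ n)) (S'P u) u_u).
    apply/cvgr0Pnorm_lt => e e0; have [d d0 H] := Tc (S' u) e e0.
    have /cvgr0Pnorm_lt/(_ _ d0) := rho_cvg0 hmu S'u.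
    apply: filterS => n /= rd.
    rewrite ger0_norm; last first.
      by apply: Rintegral_ge0 => s _; exact: rho_integrand_ge0.
    by apply: H; exact: le_lt_trans (ler_norm _) rd.
  + move=> N [KN VN]; exists N; split => //; apply/funext => f /=.
    apply/L0P; apply: filterS2 (VN (shift_operator Phi f))
      (superpositionE (shift_operator Phi f) KN) => s /= + ->.
    by rewrite S'K.
- split.
  (* The shift preserves almost everywhere convergence, and so does composition with the continuous
     functions [N s]. *)
  + apply: ae_cvg_rho_continuous => // f g gf /=.
    have Sg := shifts_cvg htr (fun n => SP (g n)) (SP f) gf.
    have NE : \forall s \ae nu, forall n, superposition N (shift_operator Phi (g n)) s =
        N s (shift_operator Phi (g n) s).
      by apply: ae_foralln => n; exact: superpositionE.
    case: (KN) => _ _ Nc.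
    apply: filterS (filterI (filterI Sg NE) (filterI Nc
      (superpositionE (shift_operator Phi f) KN))) => s [[Sgs NEs] [Ncs ->]].
    rewrite (_ : (fun n => _) = fun n => N s (shift_operator Phi (g n) s)).
      exact: (cvg_comp _ _ Sgs (Ncs _)).
    by apply/funext => n; exact: NEs.
  + move=> p /order_projectionP[D ->]; apply/funext => f /=.
    rewrite /Phi_proj proj_classK.
    have -> : shift_operator Phi (L0proj D f) = L0proj (Phi D) (shift_operator Phi f).
      exact: (shifts_L0_uniq hPhi (SP _) (shifts_L0proj hPhi D (SP f))).
    set g := shift_operator Phi f.
    case: (KN) => N0 _ _.
    apply/L0P; apply: filterS (filterI (filterI N0 (L0projE (Phi D) g))
      (filterI (filterI (superpositionE g KN) (superpositionE (L0proj (Phi D) g) KN))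
        (L0projE (Phi D) (superposition N g)))) => s [[N0s E1] [[E2 E3] E4]].
    (* Off the set representing [Phi D] the left side is [N s 0], which vanishes, and the right side
       is 0. *)
    rewrite E3 E4 E1 E2 indicE.
    by case: (_ \in _); rewrite ?mul1r// !mul0r.
Qed.
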